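(* Let \[ f(t,x):=\mathbb{E}\Big[\exp\Big(\int_t^T\sum_{i=1}^3u_i(s)p_i(X_s)ds+v(T)q(X_T)\Big)\,\Big|\,X_t=x\Big],\quad t\in[0,T],\ x\in\mathbb{R}. \] Then $f$ is $C^\infty$ in $x$, i.e. $\partial_x^kf$ exists and is continuous in $(t,x)$ for every $k\in\mathbb N$. Moreover, for each $k$ there exist a power series $q_k$ negligible to double factorial and a constant $C_k$ independent of $(t,x)$ such that \[ \Big|\frac{\partial^kf}{\partial x^k}(t,x)\Big|\le|q_k|(|x|)+C_k,\qquad t\in[0,T],\ x\in\mathbb{R}. \]
   Context: Let $W$ be a Brownian motion on a filtered probability space with usual conditions; $a,b\in\mathbb{R}$, $c\ne0$, $T>0$; $dX_t=(a+bX_t)dt+c\,dW_t$. A power series $p=\sum p_kx^k$ is negligible to double factorial if $\limsup_k(|p_k|(k-1)!!)^{1/k}=0$, $(-1)!!=0!!=1$. For a power series $q$, $|q|(x):=\sum_k|q_k|x^k$. Standing assumptions: $u_1,u_2,u_3,v:[0,T]\to\mathbb{C}$ are continuous with $\Re(u_1)\le0$ and $\Re(u_2)=\Re(u_3)=\Re(v)=0$; $p_1=p^2$ for a real-coefficient power series $p$ negligible to double factorial; $p_2,p_3,q$ are real-coefficient power series negligible to double factorial (so $p_1$ is too). *)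

(* Defs.v *)
From HB Require Import structures.
From mathcomp Require Import all_boot all_order all_algebra.
From mathcomp Require Import all_classical all_reals all_analysis.
Set Implicit Arguments. Unset Strict Implicit. Unset Printing Implicit Defensive.
Import Order.TTheory GRing.Theory Num.Theory.
Import numFieldNormedType.Exports.
Local Open Scope classical_set_scope.
Local Open Scope ring_scope.

Fixpoint dfact (n : nat) : nat :=
  match n with
  | 0 => 1
  | 1 => 1
  | S (S m as n') => (S n') * dfact m
  end%N.

(* (k-1)!! with the convention (-1)!! = 1 *)
Definition dfact_pred (k : nat) : nat := dfact k.-1.

Section Defs.
Variable R : realType.

(* a power series sum_k p_k x^k is represented by its coefficient sequence *)
Definition negligible_dfact (p : nat -> R) : Prop :=
  limn_esup (fun k : nat =>
     ((`|p k| * (dfact_pred k)%:R) `^ (k%:R^-1))%:E) = 0%E.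

Definition pvalue (p : nat -> R) (x : R) : R :=
  limn (series (fun k : nat => p k * x ^+ k)).

Definition pabs (p : nat -> R) : nat -> R := fun k => `|p k|.

Definition psquare (p : nat -> R) : nat -> R :=
  fun k => \sum_(i < k.+1) p i * p (k - i)%N.

Definition mutually_independent d (T : measurableType d)
    (P : probability T R) (n : nat) (Y : 'I_n -> T -> R) : Prop :=
  forall A : 'I_n -> set R, (forall i, measurable (A i)) ->
    P (\bigcap_(i in [set: 'I_n]) (Y i @^-1` A i)) =
    (\prod_(i < n) P (Y i @^-1` A i))%E.

Definition brownian_motion d (T : measurableType d) (P : probability T R)
    (W : R -> T -> R) : Prop :=
  [/\ (forall t, 0 <= t -> measurable_fun setT (W t)),
      {ae P, forall w, W 0 w = 0},
      (forall w, {within `[0, +oo[, continuous (fun t => W t w)}),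
      (forall s t, 0 <= s -> s < t -> forall A, measurable A ->
         P ((fun w => W t w - W s w) @^-1` A) =
         normal_prob 0 (Num.sqrt (t - s)) A) &
      (forall (n : nat) (ts : nat -> R), 0 <= ts 0%N ->
         (forall i, (i < n)%N -> ts i < ts i.+1) ->
         mutually_independent P
           (fun (i : 'I_n) w => W (ts i.+1) w - W (ts i) w))].

(* exponent  int_t^T sum_i u_i(s) p_i(X_s) ds + v(T) q(X_T),
   split into real part (uses Re u_i, Re v) and imaginary part
   (uses Im u_i, Im v); the p_i, q have real coefficients. *)
Definition exponent_part (T t : R) (u1 u2 u3 : R -> R) (v : R -> R)
    (p1 p2 p3 q : nat -> R) (X : R -> R) : R :=
  Rintegral lebesgue_measure `[t, T]
    (fun s => u1 s * pvalue p1 (X s) + u2 s * pvalue p2 (X s)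
              + u3 s * pvalue p3 (X s))
  + v T * pvalue q (X T).

End Defs.

(* Main.v *)
Require Import Defs.
From HB Require Import structures.
From mathcomp Require Import all_boot all_order all_algebra.
From mathcomp Require Import all_classical all_reals all_analysis.
From mathcomp Require Import measurable_realfun lebesgue_integral_under.
From mathcomp Require Import normal_distribution.
From mathcomp Require Import ring lra.
Import Order.TTheory GRing.Theory Num.Theory.
Import numFieldNormedType.Exports.
Set Implicit Arguments.
Unset Strict Implicit.
Local Open Scope classical_set_scope.
Local Open Scope ring_scope.

(* With U the solution started at (0, 0), the solution started at (t, x) is
   X_s = U_s + e^{b(s-t)} (x - U_t), so x enters the exponent only through the
   arguments of power series, and all x-derivatives of the integrand are
   exp(A) cos B or exp(A) sin B (bounded by 1, as A <= 0) times polynomials in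
   integrals of derivatives of the p_i and q.  Negligible series are stable under
   sums, products, dilations and differentiation, and are O(exp(eta x^2)) for every
   eta > 0; hence these derivatives are dominated by r(|x| + M) with r negligible
   and M affine in the supremum of |W|.  That supremum has a Gaussian exponential
   moment by dyadic chaining, which uses only the law of single increments.  So
   one may differentiate under the expectation, and the bound follows from
   r(x + y) <= r(2x) + r(2y). *)

(** * Power series negligible to double factorial *)

(** The exponent in the Gaussian moment is fixed, of order [1 / T], and passing from the supremum of
    [|W|] to an affine function of it shrinks what is left. The dominating functions must therefore
    grow more slowly than every Gaussian exponential, and they must form an algebra, because each
    differentiation produces more factors. Negligible series with nonnegative coefficients satisfy
    both.

    The noise is additive, so the equation is an integral equation for each path, with no stochastic
    integral. One random variable [M] then bounds [U] at all times, and all estimates are uniform in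
    [t].

    Two obstacles shape the treatment of [t]: the data live on [[0, T]] only, and [t] occurs in the
    domain of integration. Times are therefore projected onto [[0, T]] and integrands frozen before
    [t], which yields fields on all of [R * R] whose joint continuity follows from dominated
    convergence. *)

Lemma dfactSS n : dfact n.+2 = (n.+2 * dfact n)%N.
Proof. by []. Qed.

Lemma dfactS_mul_dfact n : (dfact n.+1 * dfact n)%N = n.+1`!.
Proof.
elim: n => // n IH.
by rewrite dfactSS mulnAC -mulnA IH factS.
Qed.

Lemma leq_dfactS n : (dfact n <= dfact n.+1)%N.
Proof.
suff: (dfact n <= dfact n.+1)%N /\ (dfact n.+1 <= dfact n.+2)%N by case.
elim: n => [//|n [h1 h2]]; split=> //.
by rewrite (dfactSS n) (dfactSS n.+1) leq_mul.
Qed.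

Lemma dfactS_leq n : (dfact n.+1 <= n.+1 * dfact n)%N.
Proof. by case: n => // n; rewrite dfactSS leq_mul// leq_dfactS. Qed.

(** Since [k! = k!! (k-1)!!], comparing [k!] with the square of [(k-1)!!] reduces, for positive [k],
    to [(k-1)!! <= k!! <= k (k-1)!!]. In the converse bound below, the factor [k] is absorbed by
    [2 ^ k]. *)
Lemma dfact_pred_sqr_leq k : (dfact_pred k ^ 2 <= k`!)%N.
Proof.
case: k => // k; rewrite /dfact_pred /= -dfactS_mul_dfact -mulnn.
by rewrite leq_mul2r leq_dfactS orbT.
Qed.

Lemma fact_leq_dfact_pred_sqr k : (k`! <= 2 ^ k * dfact_pred k ^ 2)%N.
Proof.
case: k => // k; rewrite /dfact_pred /= -dfactS_mul_dfact -mulnn mulnA.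
rewrite leq_mul2r; apply/orP; right; apply: (leq_trans (dfactS_leq k)).
by rewrite leq_mul2r (ltnW (ltn_expl _ _)) ?orbT.
Qed.

Section PowerSeries.
Variable R : realType.
Implicit Types (p r s : nat -> R) (x y eta C : R).

(* Equivalent to [negligible_dfact], as k! and (k-1)!!^2 agree up to a factor
   2^k; the factorial form behaves better under convolution. *)
Definition negl r := forall eta, 0 < eta -> exists C, forall k,
  r k ^+ 2 * k`!%:R <= C * eta ^+ k.

Definition cauchy_prod r s : nat -> R := fun k => \sum_(i < k.+1) r i * s (k - i)%N.

Lemma negl_cst_ge0 {r eta C} : (forall k, r k ^+ 2 * k`!%:R <= C * eta ^+ k) -> 0 <= C.
Proof.
by move=> /(_ 0%N); rewrite expr0 mulr1; apply: le_trans; rewrite mulr_ge0// sqr_ge0.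
Qed.

Lemma eq_norm_negl r s : (forall k, `|r k| <= `|s k|) -> negl s -> negl r.
Proof.
move=> rs ns eta /ns[C HC]; exists C => k; apply: le_trans (HC k).
by rewrite ler_wpM2r// -(real_normK (num_real (r k))) -(real_normK (num_real (s k))) lerXn2r ?nnegrE.
Qed.

Lemma negl_pabs r : negl r -> negl (pabs r).
Proof. by apply: eq_norm_negl => k; rewrite normr_id. Qed.

Lemma negl_cst x : negl (fun k => if k is 0%N then x else 0).
Proof.
move=> eta eta0; exists (x ^+ 2) => -[|k]; first by rewrite !mulr1.
by rewrite expr0n mul0r mulr_ge0 ?sqr_ge0// exprn_ge0// ltW.
Qed.

Lemma neglD r s : negl r -> negl s -> negl (fun k => r k + s k).
Proof.
move=> nr ns eta eta0; have [C HC] := nr _ eta0; have [D HD] := ns _ eta0.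
exists (2 * (C + D)) => k.
have : (r k + s k) ^+ 2 <= 2 * (r k ^+ 2 + s k ^+ 2).
  by have := sqr_ge0 (r k - s k); rewrite sqrrB sqrrD; lra.
move=> /(ler_wpM2r (ler0n R k`!))/le_trans; apply.
by have := HC k; have := HD k; lra.
Qed.

(** Scaling by [y] and dilation by [x] at once, in the shape used by [pvalueZ]. Dilation costs
    [x ^+ (2 * k)], which is paid by using the hypothesis at [eta / (x ^+ 2 + 1)]; the [+ 1] covers
    [x = 0]. *)
Lemma neglZ y x r : negl r -> negl (fun k => y * (x ^+ k * r k)).
Proof.
move=> nr eta eta0; have x0 : 0 < x ^+ 2 + 1 by rewrite ltr_wpDl// sqr_ge0.
have [C HC] := nr _ (divr_gt0 eta0 x0); exists (y ^+ 2 * C) => k.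
have -> : (y * (x ^+ k * r k)) ^+ 2 * k`!%:R =
    y ^+ 2 * ((x ^+ k) ^+ 2 * (r k ^+ 2 * k`!%:R)) by ring.
rewrite -mulrA; apply: ler_wpM2l; first exact: sqr_ge0.
have -> : eta ^+ k = (x ^+ 2 + 1) ^+ k * (eta / (x ^+ 2 + 1)) ^+ k.
  by rewrite -exprMn mulrCA divff ?gt_eqF// mulr1.
have xk : (x ^+ k) ^+ 2 <= (x ^+ 2 + 1) ^+ k.
  by rewrite -exprM mulnC exprM lerXn2r ?nnegrE ?sqr_ge0// ?(ltW x0)// lerDl.
have -> : C * ((x ^+ 2 + 1) ^+ k * (eta / (x ^+ 2 + 1)) ^+ k) =
  (x ^+ 2 + 1) ^+ k * (C * (eta / (x ^+ 2 + 1)) ^+ k) by ring.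
by rewrite ler_pM ?sqr_ge0// mulr_ge0 ?sqr_ge0.
Qed.

(** One of the two factors [k + 1] turns [k!] into [(k+1)!]; the other is at most [2 ^ k], hence the
    choice of [eta / 2]. *)
Lemma negl_diffs r : negl r -> negl (pseries_diffs r).
Proof.
move=> nr eta eta0; have e2 : 0 < eta / 2 by lra.
have [C HC] := nr _ e2; exists (C * (eta / 2)) => k.
have h := ler_wpM2l (ler0n R k.+1) (HC k.+1).
have -> : (pseries_diffs r k) ^+ 2 * k`!%:R = k.+1%:R * (r k.+1 ^+ 2 * k.+1`!%:R).
  by rewrite /pseries_diffs factS natrM; ring.
apply: (le_trans h).
have -> : C * (eta / 2) * eta ^+ k = 2 ^+ k * (C * (eta / 2) ^+ k.+1).
  have -> : eta ^+ k = 2 ^+ k * (eta / 2) ^+ k by rewrite -exprMn mulrCA divff// mulr1.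
  by rewrite exprS; ring.
rewrite ler_wpM2r// ?mulr_ge0 ?(negl_cst_ge0 HC) ?exprn_ge0 ?(ltW e2)//.
by rewrite -natrX ler_nat ltn_expl.
Qed.

(** Write [k!] as a binomial coefficient times [i! (k-i)!]. The coefficient costs [2 ^ k] and the
    squared number of terms, [(k+1)^2], costs [4 ^ k]; together they explain [eta / 8]. *)
Lemma negl_cauchy_prod r s : negl r -> negl s -> negl (cauchy_prod r s).
Proof.
move=> nr ns eta eta0; have e8 : 0 < eta / 8 by lra.
have [C HC] := nr _ e8; have [D HD] := ns _ e8.
have C0 := negl_cst_ge0 HC; have D0 := negl_cst_ge0 HD.
exists (C * D) => k; have f0 : 0 < k`!%:R :> R by rewrite ltr0n fact_gt0.
pose B : R := 2 ^+ k * (C * D * (eta / 8) ^+ k) / k`!%:R.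
have B0 : 0 <= B.
  by rewrite /B !mulr_ge0 ?invr_ge0 ?exprn_ge0// ltW.
have Hi (i : 'I_k.+1) : `|r i * s (k - i)%N| <= Num.sqrt B.
  rewrite -sqrtr_sqr ler_wsqrtr// /B ler_pdivlMr//.
  have ik : (i <= k)%N by rewrite -ltnS.
  rewrite -(bin_fact ik) !natrM.
  have b2 : 'C(k, i)%:R <= 2 ^+ k :> R.
    rewrite -natrX ler_nat -[2%N]/(1 + 1)%N expnDn (bigD1 i)//=.
    by rewrite !exp1n !muln1 leq_addr.
  have := ler_pM (mulr_ge0 (sqr_ge0 _) (ler0n R _))
     (mulr_ge0 (sqr_ge0 _) (ler0n R _)) (HC i) (HD (k - i)%N).
  have -> : C * (eta / 8) ^+ i * (D * (eta / 8) ^+ (k - i)) = C * D * (eta / 8) ^+ k.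
    by rewrite -[in RHS](subnKC ik) exprD; ring.
  move=> h; have := ler_pM (ler0n R _) _ b2 h.
  have r2 (v : nat -> R) j m : 0 <= v j ^+ 2 * m%:R by rewrite mulr_ge0 ?sqr_ge0.
  move=> /(_ (mulr_ge0 (r2 _ _ _) (r2 _ _ _))).
  by apply: le_trans; rewrite le_eqVlt; apply/orP; left; apply/eqP; ring.
have Hs : `|cauchy_prod r s k| <= k.+1%:R * Num.sqrt B.
  apply: (le_trans (ler_norm_sum _ _ _)).
  apply: (le_trans (ler_sum _ (fun i _ => Hi i))).
  by rewrite sumr_const card_ord mulr_natl.
have : (cauchy_prod r s k) ^+ 2 <= (k.+1%:R * Num.sqrt B) ^+ 2.
  by rewrite -(real_normK (num_real (cauchy_prod r s k))) lerXn2r ?nnegrE ?mulr_ge0 ?sqrtr_ge0.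
rewrite exprMn sqr_sqrtr// => /(ler_wpM2r (ltW f0))/le_trans; apply.
have -> : k.+1%:R ^+ 2 * B * k`!%:R = k.+1%:R ^+ 2 * (2 ^+ k * (C * D * (eta / 8) ^+ k)).
  by rewrite -mulrA; congr (_ * _); rewrite /B divfK ?gt_eqF.
have -> : eta ^+ k = 2 ^+ k * (2 ^+ k * 2 ^+ k) * (eta / 8) ^+ k.
  by rewrite -!exprMn; congr (_ ^+ _); field.
have k2 : k.+1%:R <= 2 ^+ k :> R by rewrite -natrX ler_nat ltn_expl.
have e80 : 0 <= (eta / 8) ^+ k by rewrite exprn_ge0// ltW.
have -> : C * D * (2 ^+ k * (2 ^+ k * 2 ^+ k) * (eta / 8) ^+ k) =
  (2 ^+ k) ^+ 2 * (2 ^+ k * (C * D * (eta / 8) ^+ k)) by ring.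
rewrite ler_wpM2r//; first by rewrite !mulr_ge0// exprn_ge0.
by rewrite lerXn2r ?nnegrE// exprn_ge0.
Qed.

(* AM-GM: |r_k| x^k <= r_k^2 k! / eta^k + (eta x^2)^k / k! *)
Lemma negl_sum_bound r eta : negl r -> 0 < eta ->
  exists C, forall x n, \sum_(0 <= k < n) `|r k| * `|x| ^+ k <= C + expR (eta * x ^+ 2).
Proof.
move=> nr eta0; have e2 : 0 < eta / 2 by lra.
have [C HC] := nr _ e2; have C0 := negl_cst_ge0 HC.
exists (2 * C) => x n.
have H k : `|r k| * `|x| ^+ k <= C * 2^-1 ^+ k + exp_coeff (eta * x ^+ 2) k.
  have f0 : 0 < k`!%:R :> R by rewrite ltr0n fact_gt0.
  have ek : 0 < eta ^+ k by rewrite exprn_gt0.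
  apply: (@le_trans _ _ (r k ^+ 2 * k`!%:R / eta ^+ k + exp_coeff (eta * x ^+ 2) k)); last first.
    rewrite lerD2r ler_pdivrMr//; apply: le_trans (HC k) _.
    by rewrite exprMn -mulrA (mulrC (eta ^+ k)).
  rewrite /exp_coeff /= exprMn -exprM mulnC exprM.
  rewrite -(real_normK (num_real (r k))) -(real_normK (num_real (x ^+ k))) normrX.
  set A := `|r k|; set y := `|x| ^+ k; set g := k`!%:R; set e := eta ^+ k.
  have A0 : 0 <= A by exact: normr_ge0.
  have y0 : 0 <= y by rewrite exprn_ge0.
  have s0 : 0 < g / e by rewrite divr_gt0.
  rewrite -(ler_pM2l s0).
  have -> : g / e * (A ^+ 2 * g / e + e * y ^+ 2 / g) = (A * (g / e)) ^+ 2 + y ^+ 2.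
    by field; rewrite !gt_eqF.
  have Agy : 0 <= A * (g / e) * y by rewrite mulr_ge0// mulr_ge0// ltW.
  have := sqr_ge0 (A * (g / e) - y); rewrite sqrrB.
  by move: Agy; lra.
apply: (le_trans (ler_sum _ (fun k _ => H k))).
rewrite big_split/=; apply: lerD.
  rewrite -mulr_sumr mulrC; apply: ler_wpM2r => //.
  have := @geometric_seriesE R 1 (2^-1) _; rewrite lt_eqF; last by lra.
  move=> /(_ isT)/(congr1 (fun f => f n)); rewrite /series/= /geometric/=.
  under eq_bigr do rewrite mul1r.
  move=> ->; rewrite mul1r ler_pdivrMr; last by lra.
  suff : 0 <= (2^-1 : R) ^+ n by lra.
  by rewrite exprn_ge0.
have ex0 : 0 <= eta * x ^+ 2 by rewrite mulr_ge0 ?sqr_ge0// ltW.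
apply: (@nondecreasing_cvgn_le R (series (exp_coeff (eta * x ^+ 2)))).
  apply/nondecreasing_seqP => m; rewrite /series/= big_nat_recr//= lerDl.
  by rewrite exp_coeff_ge0.
exact: is_cvg_series_exp_coeff.
Qed.

Lemma is_cvg_negl_norm r x : negl r -> cvgn (series (fun k => `|r k * x ^+ k|)).
Proof.
move=> /(@negl_sum_bound _ 1) => /(_ ltr01)[C HC].
apply: nondecreasing_is_cvgn.
  by apply/nondecreasing_seqP => m; rewrite /series/= big_nat_recr//= lerDl.
exists (C + expR (1 * x ^+ 2)) => _ [n _ <-]; rewrite /series/=.
under eq_bigr do rewrite normrM normrX.
exact: HC.
Qed.

Lemma is_cvg_negl r x : negl r -> cvgn (series (fun k => r k * x ^+ k)).
Proof. by move=> nr; apply/normed_cvg/is_cvg_negl_norm. Qed.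

Lemma pvalue_ge0 r x : (forall k, 0 <= r k) -> negl r -> 0 <= x -> 0 <= pvalue r x.
Proof.
move=> r0 nr x0; apply: limr_ge; first exact: is_cvg_negl.
by apply: nearW => n; apply: sumr_ge0 => k _; rewrite mulr_ge0// exprn_ge0.
Qed.

Lemma ler_pvalue r s x y : negl r -> negl s -> 0 <= x -> x <= y ->
  (forall k, 0 <= r k <= s k) -> pvalue r x <= pvalue s y.
Proof.
move=> nr ns x0 xy rs; apply: ler_lim; [exact: is_cvg_negl..|].
apply: nearW => n; apply: ler_sum => k _; have /andP[? ?] := rs k.
by rewrite ler_pM// ?exprn_ge0// lerXn2r ?nnegrE// (le_trans x0).
Qed.

Lemma ler_norm_pvalue r x : negl r -> `|pvalue r x| <= pvalue (pabs r) `|x|.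
Proof.
move=> nr; have := lim_series_norm (@is_cvg_negl_norm r x nr); rewrite /pvalue /pabs.
have -> // : (fun k => `|r k| * `|x| ^+ k) = (fun k => `|r k * x ^+ k|).
by apply/funext => k; rewrite normrM normrX.
Qed.

Lemma pvalueD r s x : negl r -> negl s ->
  pvalue (fun k => r k + s k) x = pvalue r x + pvalue s x.
Proof.
move=> nr ns; rewrite /pvalue -limD; [|exact: is_cvg_negl..].
congr (limn _); apply/funext => n /=; rewrite fctE /series/= -big_split/=.
by apply: eq_bigr => k _; rewrite mulrDl.
Qed.

Lemma pvalueZ y c r x : negl r ->
  pvalue (fun k => y * (c ^+ k * r k)) x = y * pvalue r (c * x).
Proof.
move=> nr; apply: cvg_lim => //.
have -> : series (fun k => y * (c ^+ k * r k) * x ^+ k) =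
    (fun n => y * series (fun k => r k * (c * x) ^+ k) n).
  apply/funext => n /=; rewrite /series/= mulr_sumr.
  by apply: eq_bigr => k _; rewrite exprMn; ring.
by apply: cvgM; [exact: cvg_cst|exact: is_cvg_negl].
Qed.

Lemma pvalue_cst c x : pvalue (fun k => if k is 0%N then c else 0) x = c.
Proof.
apply: lim_near_cst => //; near=> n.
have n0 : (0 < n)%N by near: n; exact: nbhs_infty_gt.
rewrite /series/= -(prednK n0) big_nat_recl//= mulr1 big1 ?addr0// => i _.
by rewrite mul0r.
Unshelve. all: end_near. Qed.

Lemma is_derive_pvalue r x : negl r ->
  is_derive x 1 (pvalue r) (pvalue (pseries_diffs r) x).
Proof.
(* The series and its two formal derivatives must converge at some point beyond [|x|]. *)
move=> nr; apply: (@pseries_snd_diffs _ r (`|x| + 1)).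
- exact: is_cvg_negl.
- exact/is_cvg_negl/negl_diffs.
- exact/is_cvg_negl/negl_diffs/negl_diffs.
- by rewrite [ltRHS]ger0_norm ?addr_ge0// ltrDl.
Qed.

Lemma continuous_pvalue r : negl r -> continuous (pvalue r).
Proof.
move=> nr x; apply: differentiable_continuous; apply/derivable1_diffP.
exact: (@ex_derive _ _ _ _ _ _ _ (is_derive_pvalue x nr)).
Qed.

(** * Cauchy products of series *)

Section CauchyProduct.
Variables a b : nat -> R.
Let c k := \sum_(i < k.+1) a i * b (k - i)%N.

Lemma series_cauchy_prodE n : series c n = \sum_(i < n) a i * series b (n - i)%N.
Proof.
elim: n => [|n IH]; first by rewrite /series/= big_nil big_ord0.
rewrite /series/= big_nat_recr//= -[X in X + _]/(series c n) IH big_ord_recr/= /c.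
rewrite [X in _ + X]big_ord_recr/= subnn subSnn addrA -big_split/=; congr (_ + _).
  apply: eq_bigr => i _; rewrite subSn ?(ltnW (ltn_ord i))//.
  by rewrite /series/= big_nat_recr//= mulrDr.
by rewrite big_nat1.
Qed.

End CauchyProduct.

(** The index triangle of size [n] lies in the square of size [n], which lies in the triangle of
    size [2n]. With nonnegative terms this squeezes the product of partial sums between two partial
    sums of the Cauchy product. *)
Lemma cauchy_product_ge0 (a b : nat -> R) : (forall k, 0 <= a k) -> (forall k, 0 <= b k) ->
  cvgn (series a) -> cvgn (series b) ->
  (fun n => series a n * series b n -
     series (fun k => \sum_(i < k.+1) a i * b (k - i)%N) n) @ \oo --> 0.
Proof.
move=> a0 b0 ca cb.
set c := fun k => \sum_(i < k.+1) a i * b (k - i)%N.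
have mono (s : nat -> R) : (forall k, 0 <= s k) -> {homo series s : m n / (m <= n)%N >-> m <= n}.
  by move=> s0; apply/nondecreasing_seqP => m; rewrite /series/= big_nat_recr//= lerDl.
have c0 k : 0 <= c k by apply: sumr_ge0 => i _; exact: mulr_ge0.
have seriesE (s : nat -> R) n : series s n = \sum_(i < n) s i by rewrite /series/= big_mkord.
have up n : series c n <= series a n * series b n.
  rewrite series_cauchy_prodE (seriesE a) mulr_suml; apply: ler_sum => i _.
  by rewrite ler_wpM2l// mono// leq_subr.
have lo n : series a n * series b n <= series c (n + n)%N.
  rewrite series_cauchy_prodE (seriesE a) mulr_suml big_split_ord/=.
  rewrite -[leLHS]addr0 lerD//.
    apply: ler_sum => i _; rewrite ler_wpM2l// mono// -addnBA ?leq_addr//.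
    exact: ltnW.
  apply: sumr_ge0 => i _; rewrite mulr_ge0// seriesE; exact: sumr_ge0.
have cc : cvgn (series c).
  apply: nondecreasing_is_cvgn; first exact: mono.
  exists (limn (series a) * limn (series b)) => _ [n _ <-].
  apply: (le_trans (up n)).
  rewrite ler_pM// ?nondecreasing_cvgn_le//; try exact: mono.
    by rewrite seriesE sumr_ge0.
  by rewrite seriesE sumr_ge0.
rewrite (_ : 0 = limn (series c) - limn (series c)); last by rewrite subrr.
apply: cvgB; last exact: cc.
apply: (@squeeze_cvgr _ _ _ _ (series c) (fun n => series c (n + n)%N)).
- by apply: nearW => n; rewrite up lo.
- exact: cc.
- have h : (n + n)%N @[n --> \oo] --> \oo.
    move=> A [N _ AN]; exists N => // n /= Nn; apply: AN => /=.
    by rewrite (leq_trans Nn)// leq_addr.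
  exact: (cvg_comp _ _ h cc).
Qed.

(** The gap between the product of partial sums and the partial sum of the Cauchy product is a sum
    over index pairs outside the triangle. It is bounded by the same gap for the absolute values,
    which tends to 0 by the nonnegative case. *)
Lemma pvalue_cauchy_prod r s x : negl r -> negl s ->
  pvalue (cauchy_prod r s) x = pvalue r x * pvalue s x.
Proof.
move=> nr ns; pose a k := r k * x ^+ k; pose b k := s k * x ^+ k.
have convE : (fun k => cauchy_prod r s k * x ^+ k) = fun k => \sum_(i < k.+1) a i * b (k - i)%N.
  apply/funext => k; rewrite /cauchy_prod mulr_suml; apply: eq_bigr => i _.
  have ik : (i <= k)%N by rewrite -ltnS.
  have -> : x ^+ k = x ^+ i * x ^+ (k - i) by rewrite -exprD subnKC.
  by rewrite /a /b; ring.
have ca := @is_cvg_negl r x nr; have cb := @is_cvg_negl s x ns.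
have h := cauchy_product_ge0 (fun k => normr_ge0 (a k)) (fun k => normr_ge0 (b k))
   (@is_cvg_negl_norm r x nr) (@is_cvg_negl_norm s x ns).
apply: cvg_lim => //; rewrite convE.
set c := (X in series X).
have -> : series c = (fun n => series a n * series b n - (series a n * series b n - series c n)).
  by apply/funext => n; rewrite opprB addrC subrK.
rewrite -[X in _ --> X]subr0; apply: cvgB; first exact: cvgM.
apply: norm_cvg0; apply: squeeze_cvgr (cvg_cst 0) h; apply: nearW => n.
rewrite normr_ge0/= !series_cauchy_prodE (series_cauchy_prodE (fun k => `|a k|) (fun k => `|b k|)).
have sE (u : nat -> R) (v : nat -> R) : series u n * series v n - \sum_(i < n) u i * series v (n - i)%N
   = \sum_(i < n) u i * (series v n - series v (n - i)%N).
  rewrite {1}/series/= big_mkord mulr_suml -sumrB; apply: eq_bigr => i _.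
  by rewrite mulrBr.
rewrite !sE; apply: (le_trans (ler_norm_sum _ _ _)); apply: ler_sum => i _.
rewrite normrM ler_wpM2l// /series/=.
rewrite !(@big_cat_nat _ _ _ (n - i)%N 0%N n)//= ?leq_subr//.
by rewrite addrAC subrr add0r [leRHS]addrAC subrr add0r ler_norm_sum.
Qed.

Lemma pvalue_bound r eta : negl r -> 0 < eta ->
  exists C, forall x, `|pvalue r x| <= C + expR (eta * x ^+ 2).
Proof.
move=> nr /(negl_sum_bound nr)[C HC]; exists C => x.
apply: le_trans (ler_norm_pvalue _ nr) _.
apply: limr_le; first exact/is_cvg_negl/negl_pabs.
by apply: nearW => n; exact: HC.
Qed.

(* x + y <= 2 max(x, y) *)
Lemma pvalue_add_le r x y : (forall k, 0 <= r k) -> negl r -> 0 <= x -> 0 <= y ->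
  pvalue r (x + y) <= pvalue r (2 * x) + pvalue r (2 * y).
Proof.
move=> r0 nr x0 y0; have le k : 0 <= r k <= r k by rewrite r0 /=.
have [xy|yx] := leP x y.
  apply: (@le_trans _ _ (pvalue r (2 * y))).
    by apply: ler_pvalue => //; [rewrite addr_ge0|lra].
  by rewrite lerDr pvalue_ge0// mulr_ge0.
apply: (@le_trans _ _ (pvalue r (2 * x))).
  by apply: ler_pvalue => //; [rewrite addr_ge0|lra].
by rewrite lerDl pvalue_ge0// mulr_ge0.
Qed.

Lemma negligible_dfactP r : negligible_dfact r <-> negl r.
Proof.
rewrite /negligible_dfact; set a := fun k => `|r k| * (dfact_pred k)%:R.
have a0 k : 0 <= a k by rewrite mulr_ge0.
have a2 k : r k ^+ 2 * (dfact_pred k ^ 2)%:R = a k ^+ 2.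
  by rewrite /a exprMn real_normK ?num_real// natrX.
split=> [h eta eta0|nr].
  have e : 0 < eta / 2 by lra.
  pose e' := Num.sqrt (eta / 2); have e'0 : 0 < e' by rewrite sqrtr_gt0.
  have : (fun k => (a k `^ k%:R^-1)%:E) @ \oo --> 0%E.
    by apply: limn_esup_le_cvg; [rewrite h|move=> k; rewrite lee_fin powR_ge0].
  move=> /fine_cvgP[_] /cvgr0_norm_lt/(_ _ e'0)[N _ HN].
  (* [C] takes care of the finitely many indices up to [N]. Beyond them, the root bound
     [sqrt (eta / 2)] leaves a spare [2 ^ k] for passing from the squared double factorial to
     [k!]. *)
  pose C := \sum_(k < N.+1) r k ^+ 2 * k`!%:R / eta ^+ k.
  have C0 (P : pred 'I_N.+1) : 0 <= \sum_(k < N.+1 | P k) r k ^+ 2 * k`!%:R / eta ^+ k.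
    apply: sumr_ge0 => k _; apply: mulr_ge0; first by rewrite mulr_ge0 ?sqr_ge0.
    by rewrite invr_ge0 exprn_ge0// ltW.
  exists (1 + C) => k; have ek : 0 < eta ^+ k by rewrite exprn_gt0.
  have [kN|Nk] := ltnP k N.+1.
    rewrite -ler_pdivrMr// /C (bigD1 (Ordinal kN))//= addrCA lerDl addr_ge0//.
  apply: (@le_trans _ _ (eta ^+ k)); last by rewrite ler_peMl ?(ltW ek)// lerDl C0.
  have k0 : k%:R != 0 :> R by rewrite pnatr_eq0 -lt0n (leq_trans _ Nk).
  have ak : a k <= e' ^+ k.
    have : a k `^ k%:R^-1 <= e'.
      by have := HN k (ltnW Nk); rewrite /= ger0_norm ?powR_ge0// => /ltW.
    move=> /(lerXn2r k); rewrite !nnegrE powR_ge0 (ltW e'0) => /(_ isT isT).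
    by rewrite -powR_mulrn ?powR_ge0// -powRrM mulVf// powRr1.
  have : a k ^+ 2 <= (eta / 2) ^+ k.
    rewrite -[eta / 2]sqr_sqrtr ?(ltW e)// -exprM mulnC exprM.
    by rewrite lerXn2r// nnegrE// exprn_ge0// ltW.
  rewrite -a2 => h2.
  apply: (@le_trans _ _ (r k ^+ 2 * (2 ^ k * dfact_pred k ^ 2)%:R)).
    by rewrite ler_wpM2l ?sqr_ge0// ler_nat fact_leq_dfact_pred_sqr.
  rewrite natrM mulrCA natrX.
  apply: le_trans (ler_wpM2l (exprn_ge0 k (ler0n R 2)) h2) _.
  by rewrite -exprMn mulrCA divff// mulr1.
suff cv : (fun k => (a k `^ k%:R^-1)%:E) @ \oo --> 0%E.
  have [_ ->] := cvg_limn_einf_sup cv; by [].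
apply: cvg_EFin; first exact: nearW.
(* The square matches the squared terms in [negl]; the division by 2 leaves a factor [4 ^ k] that
   eventually exceeds [C]. *)
apply/cvgr0Pnorm_le => eta eta0; pose e := (eta / 2) ^+ 2.
have e0 : 0 < e by rewrite exprn_gt0//; lra.
have [C HC] := nr _ e0; have C0 := negl_cst_ge0 HC.
near=> k.
have k0 : k%:R != 0 :> R by rewrite pnatr_eq0 -lt0n; near: k; exact: nbhs_infty_gt.
have Ck : C <= 2 ^+ k.
  apply: (@le_trans _ _ k%:R); last by rewrite -natrX ler_nat ltnW// ltn_expl.
  near: k; exact: nbhs_infty_ger.
have : a k ^+ 2 <= (eta ^+ k) ^+ 2.
  rewrite -a2; apply: (@le_trans _ _ (r k ^+ 2 * k`!%:R)).
    by rewrite ler_wpM2l ?sqr_ge0// ler_nat dfact_pred_sqr_leq.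
  apply: (le_trans (HC k)); rewrite /e.
  have -> : (eta ^+ k) ^+ 2 = 4 ^+ k * ((eta / 2) ^+ 2) ^+ k.
    by rewrite -exprM mulnC exprM -exprMn; congr (_ ^+ _); field.
  apply: ler_wpM2r; first by apply: exprn_ge0; exact: sqr_ge0.
  by apply: (le_trans Ck); apply: lerXn2r; rewrite ?nnegrE//; lra.
rewrite ler_sqr ?nnegrE ?exprn_ge0 ?(ltW eta0)// => ak.
rewrite /= ger0_norm ?powR_ge0//.
have := ge0_ler_powR (r := k%:R^-1) _ (a0 k) (exprn_ge0 k (ltW eta0)) ak.
rewrite invr_ge0 ler0n => /(_ isT)/le_trans; apply.
by rewrite -powR_mulrn ?(ltW eta0)// -powRrM mulfV// powRr1// ltW.
Unshelve. all: end_near. Qed.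

End PowerSeries.

(** * Calculus *)

Section Continuity.
Variable R : realType.

(** Brings continuity in a parameter, here a point of [R * R], within reach of dominated
    convergence, which concerns sequences. *)
Lemma continuous_at_seq (V : pseudoMetricType R) (f : V -> R) (z : V) :
  (forall u : nat -> V, u @ \oo --> z -> (f \o u) @ \oo --> f z) -> f @ z --> f z.
Proof.
move=> H; apply: contrapT => /cvgrPdist_lt/existsNP[e /not_implyP[e0 nf]].
have H' n : exists y, ball z n.+1%:R^-1 y /\ e <= `|f z - f y|.
  apply: contrapT => /forallNP h; apply: nf; near=> y.
  rewrite ltNge; apply/negP => ey; apply: (h y); split => //.
  by near: y; apply: nbhsx_ballx; rewrite invr_gt0.
have [u Hu] := choice H'.
have uz : u @ \oo --> z.
  apply/cvg_ballP => d d0; near=> n; have [h _] := Hu n.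
  apply: le_ball h; apply/ltW; near: n; exact: (near_infty_natSinv_lt (PosNum d0)).
have /cvgrPdist_lt/(_ _ e0)[N _ /(_ N (leqnn N))/=] := H u uz.
by have [_] := Hu N; rewrite leNgt => /negP.
Unshelve. all: end_near. Qed.

(** The projection onto [[a, b]]; precomposition with it turns continuity within the interval into
    continuity on the whole line. *)
Definition clamp (a b s : R) : R := Num.max a (Num.min s b).

Lemma clamp_in a b s : a <= b -> a <= clamp a b s <= b.
Proof.
by move=> ab; rewrite /clamp le_max lexx /= ge_max ab ge_min lexx orbT.
Qed.

Lemma clamp_id a b s : a <= s <= b -> clamp a b s = s.
Proof. by move=> /andP[as_ sb]; rewrite /clamp min_l// max_r. Qed.

Lemma continuous_clamp a b : continuous (clamp a b).
Proof.
move=> s; apply: (@continuous_max R _ (fun=> a) (fun s => Num.min s b)).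
  exact: cvg_cst.
by apply: (@continuous_min R _ id (fun=> b)); [exact: cvg_id|exact: cvg_cst].
Qed.

Lemma continuous_comp_clamp (f : R -> R) a b : a <= b -> {within `[a, b], continuous f} ->
  continuous (fun s => f (clamp a b s)).
Proof.
move=> ab /subspace_continuousP cf s.
have abs : `[a, b]%classic (clamp a b s) by rewrite /= in_itv/= clamp_in.
apply: cvg_comp (cf _ abs) => A [d /= d0 dA].
have /cvgrPdist_lt/(_ _ d0) := @continuous_clamp a b s; rewrite near_simpl/=.
apply: filterS => y sy; apply: dA => //.
by rewrite /= in_itv/= clamp_in.
Qed.

Lemma continuous_bounded_itv (f : R -> R) a b : {within `[a, b], continuous f} ->
  exists2 C, 0 <= C & forall s, a <= s <= b -> `|f s| <= C.
Proof.
move=> cf; have /compact_bounded[M [_ HM]] := continuous_compact cf (@segment_compact _ a b).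
exists (`|M| + 1) => [|s ab]; first by rewrite addr_ge0.
apply: HM; first by rewrite ltr_pwDr// ler_norm.
by exists s.
Qed.

Lemma continuous_unif_itv (h : R -> R) a b e : continuous h -> 0 < e ->
  \forall n \near \oo, forall s y, a <= s <= b -> `|y - s| <= n.+1%:R^-1 -> `|h y - h s| < e.
Proof.
move=> ch e0.
have /compact_near_coveringP/(_ nat \oo
   (fun n s => forall y, `|y - s| <= n.+1%:R^-1 -> `|h y - h s| < e)) := @segment_compact R a b.
move=> H; have {H} : \forall n \near \oo, `[a, b]%classic `<=`
    (fun s => forall y, `|y - s| <= n.+1%:R^-1 -> `|h y - h s| < e).
  apply: H => s _.
  have e2 : 0 < e / 2 by lra.
  have /cvgrPdist_lt/(_ _ e2) [d /= d0 dh] := ch s.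
  have d2 : 0 < d / 2 by lra.
  have h1 : \forall s' \near s, `|s - s'| < d / 2 by exists (d / 2).
  have h2 : \forall n \near \oo, n.+1%:R^-1 < d / 2 by exact: (near_infty_natSinv_lt (PosNum d2)).
  near=> s' n => y /= ys' /=.
  have s's : `|s - s'| < d / 2 by near: s'.
  have nd : n.+1%:R^-1 < d / 2 by near: n.
  have A1 : `|h s - h s'| < e / 2 by apply: dh => /=; lra.
  have A2 : `|h s - h y| < e / 2.
    apply: dh => /=; rewrite (le_lt_trans (ler_distD s' s y))// (splitr d) ltrD//.
    by rewrite distrC (le_lt_trans ys').
  rewrite (le_lt_trans (ler_distD (h s) (h y) (h s')))// (splitr e) ltrD//.
  by rewrite distrC.
move=> H0; apply: filterS H0 => n H s y sab; by apply: (H s) => //; rewrite /= in_itv/=.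
Unshelve. all: end_near. Qed.

End Continuity.

Section Calculus.
Variable R : realType.
Notation mu := (@lebesgue_measure R).

Lemma continuous_integrable_itv (f : R -> R) a b : continuous f ->
  mu.-integrable `[a, b] (EFin \o f).
Proof.
move=> cf; apply: continuous_compact_integrable; first exact: segment_compact.
exact: continuous_subspaceT.
Qed.

Lemma is_derive_primitive (f : R -> R) (a s : R) : continuous f -> a < s ->
  is_derive s 1 (fun x => \int[mu]_(t in `[a, x]) f t) (f s).
Proof.
move=> cf as_.
have s1 : s < s + 1 by rewrite ltrDl.
have [d1 d2] := continuous_FTC1_closed s1 (continuous_integrable_itv a (s + 1) cf) as_ (cf s).
by apply: DeriveDef; [exact: d1|rewrite -derive1E; exact: d2].
Qed.

Lemma Rintegral_FTC (f F : R -> R) (a b : R) : a <= b -> continuous f ->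
  (forall s, a <= s <= b -> is_derive s 1 F (f s)) ->
  \int[mu]_(s in `[a, b]) f s = F b - F a.
Proof.
rewrite le_eqVlt => /predU1P[<- _ _|ab cf dF].
  by rewrite set_itv1 Rintegral_set1 subrr.
have cF s : a <= s <= b -> F @ s --> F s.
  move=> sab; apply/differentiable_continuous/derivable1_diffP.
  exact: (@ex_derive _ _ _ _ _ _ _ (dF s sab)).
rewrite /Rintegral (@continuous_FTC2 _ f F)//.
- exact: continuous_subspaceT.
- split.
  + move=> s /[!in_itv]/= /andP[/ltW a' /ltW b']; apply: ex_derive; apply: dF.
    by rewrite a' b'.
  + by apply: cvg_at_right_filter; apply: cF; rewrite lexx ltW.
  + by apply: cvg_at_left_filter; apply: cF; rewrite lexx ltW.
- move=> s /[!in_itv]/= /andP[/ltW a' /ltW b']; rewrite derive1E.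
  by have sab : a <= s <= b by [rewrite a' b']; have := dF s sab => ?; rewrite derive_val.
Qed.

Lemma Rintegral_itv_split (f : R -> R) a b c : continuous f -> a <= b -> b <= c ->
  \int[mu]_(s in `[a, c]) f s =
  \int[mu]_(s in `[a, b]) f s + \int[mu]_(s in `[b, c]) f s.
Proof.
move=> cf ab bc; have := @Rintegral_itvB R f (BLeft a) (BRight c) b
  (continuous_integrable_itv a c cf); rewrite !bnd_simp => /(_ ab bc).
rewrite Rintegral_itv_obnd_cbnd; first by move=> <-; rewrite subrKC.
apply: integrableS (continuous_integrable_itv b c cf) => //.
exact: subset_itv_oc_cc.
Qed.

(* With J the primitive of D, (e^{-bs} J_s)' = e^{-bs} g_s. *)
Lemma linear_integral_eq (b : R) (D g : R -> R) t T : continuous D -> continuous g ->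
  (forall s, t <= s <= T -> D s = g s + b * \int[mu]_(r in `[t, s]) D r) ->
  forall s, t <= s <= T ->
  D s = g s + b * expR (b * s) * \int[mu]_(r in `[t, s]) (expR (- b * r) * g r).
Proof.
move=> cD cg HD s /andP[ts sT].
(* Starting the primitive at [t - 1] makes it differentiable from both sides at the endpoint [t]
   too. *)
pose J s := \int[mu]_(r in `[t - 1, s]) D r - \int[mu]_(r in `[t - 1, t]) D r.
have t1 : t - 1 < t by rewrite ltrBlDr ltrDl.
have JE r : t <= r -> J r = \int[mu]_(r in `[t, r]) D r.
  by move=> tr; rewrite /J (@Rintegral_itv_split D (t - 1) t r cD (ltW t1) tr) addrAC subrr add0r.
have dJ r : t <= r <= s -> is_derive r 1 (fun r => expR (- b * r) * J r) (expR (- b * r) * g r).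
  move=> /andP[tr rs].
  have dP := is_derive_primitive cD (lt_le_trans t1 tr).
  have dE : is_derive r 1 (fun r => expR (- b * r)) (- b * expR (- b * r)).
    by apply: is_derive_eq; rewrite /GRing.scale/=; ring.
  have dJ0 : is_derive r 1 J (D r).
    by rewrite /J; apply: is_derive_eq; rewrite subr0.
  have := HD r; rewrite tr (le_trans rs sT) => /(_ isT); rewrite -JE// => DE.
  by apply: is_derive_eq; rewrite /GRing.scale/= DE; ring.
have cE : continuous (fun r => expR (- b * r) * g r).
  move=> r; apply: cvgM; last exact: cg.
  apply: (cvg_comp (fun r => - b * r) expR); last exact: continuous_expR.
  by apply: cvgM; [exact: cvg_cst|exact: cvg_id].
rewrite (Rintegral_FTC ts cE dJ) HD ?ts// -JE// /J subrr mulr0 subr0.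
by rewrite mulNr expRN; field; exact: lt0r_neq0 (expR_gt0 _).
Qed.

Lemma linear_integral_eq_cst (b : R) (D : R -> R) g0 t T : continuous D ->
  (forall s, t <= s <= T -> D s = g0 + b * \int[mu]_(r in `[t, s]) D r) ->
  forall s, t <= s <= T -> D s = expR (b * (s - t)) * g0.
Proof.
move=> cD HD s /andP[ts sT].
rewrite (@linear_integral_eq b D (fun=> g0) t T)// ?ts//; last by move=> ?; exact: cvg_cst.
have cE : continuous (fun r => b * (expR (- b * r) * g0)).
  move=> r; apply: cvgM; first exact: cvg_cst.
  apply: cvgM; last exact: cvg_cst.
  apply: (cvg_comp (fun r => - b * r) expR); last exact: continuous_expR.
  by apply: cvgM; [exact: cvg_cst|exact: cvg_id].
have cE' : continuous (fun r => expR (- b * r) * g0).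
  move=> r; apply: cvgM; last exact: cvg_cst.
  apply: (cvg_comp (fun r => - b * r) expR); last exact: continuous_expR.
  by apply: cvgM; [exact: cvg_cst|exact: cvg_id].
have dE r : t <= r <= s -> is_derive r 1 (fun r => - (expR (- b * r) * g0)) (b * (expR (- b * r) * g0)).
  by move=> _; apply: is_derive_eq; rewrite /GRing.scale/=; ring.
have := Rintegral_FTC ts cE dE.
rewrite RintegralZl//; last exact: continuous_integrable_itv.
move=> I; rewrite -mulrA mulrCA I.
have E : expR (b * (s - t)) = expR (b * s) * expR (- b * t) by rewrite -expRD; congr expR; ring.
have E1 : expR (b * s) * expR (- b * s) = 1 by rewrite -expRD mulNr subrr expR0.
rewrite E -[X in X + _]mul1r -E1; ring.
Qed.

Lemma continuous_under_integral_seq d (Y : measurableType d) (m : {measure set Y -> \bar R})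
  (V : pseudoMetricType R) (F : V -> Y -> R) (B : set Y) (z : V) (G : Y -> R) :
  measurable B -> (forall v, measurable_fun B (F v)) ->
  (forall y, B y -> (F ^~ y) @ z --> F z y) ->
  m.-integrable B (EFin \o G) ->
  (\forall v \near z, forall y, B y -> `|F v y| <= G y) ->
  (fun v => \int[m]_(y in B) F v y) @ z --> \int[m]_(y in B) F z y.
Proof.
move=> mB mF cF iG FG; apply: continuous_at_seq => u uz.
have [N _ HN] := uz _ FG.
(* Domination holds only near [z], so the first [N] terms of the sequence are dropped. *)
rewrite -(cvg_shiftn N); apply: fine_cvg.
have zG y : B y -> `|F z y| <= G y by move=> By; exact: (nbhs_singleton FG).
rewrite fineK; last first.
  apply: integrable_fin_num => //; apply: le_integrable iG => //.
    exact/measurable_EFinP.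
  by move=> y By /=; rewrite lee_fin (le_trans (zG y By))// ler_norm.
apply: (@dominated_cvg _ _ _ m _ _ (fun n y => (F (u (n + N)%N) y)%:E) _ (EFin \o G)) => //.
- by move=> n; exact/measurable_EFinP.
- move=> y By; apply: cvg_EFin; first exact: nearW.
  have := cvg_comp _ _ uz (cF y By).
  by rewrite -(cvg_shiftn N).
- by move=> n y By; rewrite lee_fin; apply: HN => //=; exact: leq_addl.
Qed.

(* The integral is a limit of Riemann sums, which are measurable in y. *)
Lemma measurable_Rintegral_itv d (Y : measurableType d) (h : R -> Y -> R) a b : a <= b ->
  (forall y, continuous (h ^~ y)) -> (forall s, measurable_fun setT (h s)) ->
  measurable_fun setT (fun y => \int[mu]_(s in `[a, b]) h s y).
Proof.
move=> ab ch mh.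
pose dl n : R := (b - a) / n.+1%:R.
pose S n y := \sum_(k < n.+1) dl n * h (a + k%:R * dl n) y.
apply: (@measurable_fun_cvg _ _ _ setT S) => //.
  move=> n; apply: measurable_sum => k; apply: measurable_funM => //; exact: mh.
move=> y _; have ba : 0 <= b - a by lra.
apply/cvgrPdist_le => e e0.
(* The [+ 1] keeps the denominator positive when [a = b]. *)
pose e' := e / (b - a + 1); have e'0 : 0 < e' by rewrite divr_gt0//; lra.
have [N _ HN] := continuous_unif_itv a b (ch y) e'0.
near=> n.
have dn : dl n <= N.+1%:R^-1.
  rewrite /dl ler_pdivrMr// mulrC ler_pdivlMr//.
  near: n; exists (Num.bound ((b - a) * N.+1%:R)) => // n /= Hn.
  apply: (@le_trans _ _ n%:R); last by rewrite ler_nat.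
  apply: (@le_trans _ _ (Num.bound ((b - a) * N.+1%:R))%:R); last by rewrite ler_nat.
  by apply/ltW/archi_boundP; rewrite mulr_ge0.
have dn0 : 0 <= dl n by rewrite divr_ge0.
have part k : (k <= n.+1)%N -> \int[mu]_(s in `[a, a + k%:R * dl n]) h s y =
   \sum_(i < k) \int[mu]_(s in `[a + i%:R * dl n, a + i.+1%:R * dl n]) h s y.
  elim: k => [|k IH] kn; first by rewrite mul0r addr0 set_itv1 Rintegral_set1 big_ord0.
  rewrite big_ord_recr/= -IH ?(ltnW kn)//; apply: Rintegral_itv_split => //.
    by rewrite lerDl mulr_ge0.
  by rewrite lerD2l ler_wpM2r// ler_nat.
have -> : b = a + n.+1%:R * dl n by rewrite /dl mulrC divfK ?pnatr_eq0// subrKC.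
rewrite part// /S -sumrB; apply: (le_trans (ler_norm_sum _ _ _)).
have H (k : 'I_n.+1) : `|\int[mu]_(s in `[a + k%:R * dl n, a + k.+1%:R * dl n]) h s y -
    dl n * h (a + k%:R * dl n) y| <= dl n * e'.
  set l := a + k%:R * dl n; set r := a + k.+1%:R * dl n.
  have rl : r = l + dl n by rewrite /r /l -addrA -natr1 mulrDl mul1r.
  have lr : l <= r by rewrite rl lerDl.
  have lab : a <= l <= b.
    rewrite lerDl mulr_ge0//= /l -lerBrDl /dl mulrCA ler_piMr//.
    by rewrite ler_pdivrMr// mul1r ler_nat ltnW.
  have fin : mu `[l, r] = (dl n)%:E.
    rewrite lebesgue_measure_itv/= lte_fin; case: ltP => [_|].
      by rewrite rl -EFinB addrAC subrr add0r.
    by rewrite rl gerDl => h0; congr EFin; apply/esym/eqP; rewrite eq_le h0 dn0.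
  have cstE k' : dl n * k' = \int[mu]_(s in `[l, r]) k'.
    transitivity (k' * fine (mu `[l, r])); first by rewrite fin mulrC.
    by apply/esym; exact: Rintegral_cst.
  rewrite (cstE (h l y)).
  rewrite -RintegralB//; [|exact: continuous_integrable_itv|]; last first.
    by apply: continuous_integrable_itv => ?; exact: cvg_cst.
  have cB : continuous (fun s => h s y - h l y).
    by move=> s; apply: cvgB; [exact: ch|exact: cvg_cst].
  apply: (le_trans (le_normr_Rintegral _ _)) => //; first exact: continuous_integrable_itv.
  rewrite cstE.
  apply: le_Rintegral => //.
  - by apply: continuous_integrable_itv => s; apply: cvg_norm; exact: cB.
  - by apply: continuous_integrable_itv => ?; exact: cvg_cst.
  - move=> s /=; rewrite in_itv/= => /andP[ls sr]; apply/ltW/(HN N (leqnn N)) => //.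
    by rewrite ger0_norm ?subr_ge0// lerBlDl (le_trans sr)// rl lerD2l.
apply: (le_trans (ler_sum _ (fun k _ => H k))).
have -> : \sum_(k < n.+1) dl n * e' = (b - a) * e'.
  by rewrite sumr_const card_ord -mulr_natl mulrA /dl [n.+1%:R * _]mulrC divfK ?pnatr_eq0.
rewrite /e' mulrCA ler_piMr ?(ltW e0)// ler_pdivrMr; first by rewrite mul1r lerDl.
by rewrite ltr_wpDl.
Unshelve. all: end_near. Qed.

End Calculus.

(** * Exponential moments of the Brownian supremum *)

Section Gaussian.
Variable R : realType.
Notation mu := (@lebesgue_measure R).

(** The Radon-Nikodym derivative of the normal law agrees almost everywhere with [normal_pdf], as
    both integrate to the law over every measurable set. *)
Lemma integral_normal_prob_ge0 (m s : R) (g : R -> \bar R) : s != 0 ->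
  measurable_fun setT g -> (forall x, (0 <= g x)%E) ->
  (\int[normal_prob m s]_x g x = \int[mu]_x (g x * (normal_pdf m s x)%:E))%E.
Proof.
move=> s0 mg g0; have dom := @normal_prob_dominates R m s.
rewrite -(Radon_Nikodym_SigmaFinite.change_of_variables dom)//.
have mf := measurable_int _ (Radon_Nikodym_SigmaFinite.f_integrable dom).
have mpdf : measurable_fun setT (fun x => (normal_pdf m s x)%:E).
  by apply/measurable_EFinP; exact: measurable_normal_pdf.
apply: ae_eq_integral => //.
- exact: emeasurable_funM.
- exact: emeasurable_funM.
- apply: ae_eqe_mul2l => /=; apply: integral_ae_eq => //.
    exact: Radon_Nikodym_SigmaFinite.f_integrable.
  by move=> E _ mE; rewrite -Radon_Nikodym_SigmaFinite.f_integral.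
Qed.

(** The exponential halves the rate of the Gaussian: the integrand is [sqrt 2] times the normal
    density with standard deviation [sqrt 2 * s]. *)
Lemma integral_normal_expR_sqr (s : R) : 0 < s ->
  (\int[normal_prob 0 s]_x (expR (x ^+ 2 / (4 * s ^+ 2)))%:E = (Num.sqrt 2)%:E)%E.
Proof.
move=> s0; have sn0 := lt0r_neq0 s0.
have msq : measurable_fun setT (fun x : R => (expR (x ^+ 2 / (4 * s ^+ 2)))%:E).
  apply/measurable_EFinP; apply: measurableT_comp => //.
  by apply: measurable_funM => //; exact: measurable_funX.
rewrite integral_normal_prob_ge0//.
have s20 : Num.sqrt 2 * s != 0 by rewrite mulf_neq0// sqrtr_eq0 -ltNge.
rewrite -[RHS]mule1 -(integral_normal_pdf 0 (Num.sqrt 2 * s)).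
rewrite -integralZl; [|by []|exact: integrable_normal_pdf].
apply: eq_integral => x _; rewrite -!EFinM; congr EFin.
rewrite /normal_pdf (negbTE sn0) (negbTE s20) /normal_fun /normal_peak !subr0.
have -> : (Num.sqrt 2 * s) ^+ 2 * pi *+ 2 = 2 * (s ^+ 2 * pi *+ 2).
  by rewrite exprMn sqr_sqrtr//; ring.
rewrite [Num.sqrt (2 * _)]sqrtrM// exprMn sqr_sqrtr//.
have -> : expR (- x ^+ 2 / (2 * s ^+ 2 *+ 2)) =
    expR (x ^+ 2 / (4 * s ^+ 2)) * expR (- x ^+ 2 / (s ^+ 2 *+ 2)).
  by rewrite -expRD; congr expR; field.
have r2 : Num.sqrt 2 != 0 :> R by rewrite sqrtr_eq0 -ltNge.
have A0 : Num.sqrt (s ^+ 2 * pi *+ 2) != 0.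
  rewrite sqrtr_eq0 -ltNge mulrn_wgt0// mulr_gt0 ?pi_gt0// exprn_gt0//.
by field; rewrite r2 A0.
Qed.

Lemma integral_gaussian_expR_sqr d (T : measurableType d) (P : probability T R) (X : T -> R) (s : R) :
  0 < s -> measurable_fun setT X ->
  (forall A, measurable A -> P (X @^-1` A) = normal_prob 0 s A) ->
  (\int[P]_x (expR (X x ^+ 2 / (4 * s ^+ 2)))%:E = (Num.sqrt 2)%:E)%E.
Proof.
move=> s0 mX lawX; rewrite -(integral_normal_expR_sqr s0).
pose g (x : R) := (expR (x ^+ 2 / (4 * s ^+ 2)))%:E.
have mg : measurable_fun setT g.
  apply/measurable_EFinP; apply: measurableT_comp => //.
  by apply: measurable_funM => //; exact: measurable_funX.
have mX' : measurable_fun setT (X : T -> measurableTypeR R) := mX.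
pose phi : {mfun T >-> measurableTypeR R} :=
  HB.pack (X : T -> measurableTypeR R) (isMeasurableFun.Build _ _ T (measurableTypeR R) X mX').
have -> : (\int[normal_prob 0 s]_x g x = \int[pushforward P phi]_x g x)%E.
  apply: (@eq_measure_integral _ _ R setT (pushforward P phi) (normal_prob 0 s) g) => A mA _.
  by apply/esym; exact: lawX.
rewrite (@ge0_integral_pushforward _ _ _ _ _ _ mX')//.
by move=> x _; rewrite lee_fin expR_ge0.
Qed.

(* The factor y^4 makes the sum of the expectations over all dyadic increments
   converge. *)
Definition psi (e y : R) : R := y ^+ 4 * expR (e * y ^+ 2).

Lemma psi_ge0 e y : 0 <= psi e y.
Proof. by rewrite /psi mulr_ge0 ?expR_ge0// exprn_even_ge0. Qed.

Lemma ler_psi e x y : 0 <= e -> 0 <= x -> x <= y -> psi e x <= psi e y.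
Proof.
move=> e0 x0 xy; have y0 := le_trans x0 xy.
rewrite ler_pM ?exprn_ge0 ?expR_ge0 ?lerXn2r// ler_expR ler_wpM2l//.
by rewrite lerXn2r.
Qed.

(** The second-order term of the exponential series at [z^2 / 8] is [z^4 / 128], so one factor
    [expR (z ^+ 2 / 8)] absorbs [z^4]. The exponential in [psi] is at most a second such factor, and
    their product has the exponent integrated in [integral_normal_expR_sqr]. *)
Lemma psi_scale_le e r z : 0 <= e -> 0 <= r -> e * r ^+ 2 <= 8^-1 ->
  psi e (r * z) <= 128 * r ^+ 4 * expR (z ^+ 2 / 4).
Proof.
move=> e0 r0 er.
have h : z ^+ 4 <= 128 * expR (z ^+ 2 / 8).
  have z2 : 0 <= z ^+ 2 / 8 by rewrite divr_ge0// sqr_ge0.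
  have := expR_ge1Dxn 1 z2; rewrite (_ : 2`!%:R = 2)//.
  have -> : (z ^+ 2 / 8) ^+ 2 / 2 = z ^+ 4 / 128 by field.
  by lra.
have -> : expR (z ^+ 2 / 4) = expR (z ^+ 2 / 8) * expR (z ^+ 2 / 8).
  by rewrite -expRD; congr expR; field.
rewrite /psi exprMn.
have -> : 128 * r ^+ 4 * (expR (z ^+ 2 / 8) * expR (z ^+ 2 / 8)) =
  r ^+ 4 * (128 * expR (z ^+ 2 / 8)) * expR (z ^+ 2 / 8) by ring.
have z4 : 0 <= z ^+ 4 by rewrite exprn_even_ge0.
have r4 : 0 <= r ^+ 4 by rewrite exprn_even_ge0.
apply: ler_pM; [exact: mulr_ge0|exact: expR_ge0| |].
  exact: ler_wpM2l.
by rewrite ler_expR exprMn mulrA [leRHS]mulrC ler_wpM2r// sqr_ge0.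
Qed.

Lemma expR_sqr_le_psi e y : 0 <= e -> expR (e * y ^+ 2) <= expR e + psi e y.
Proof.
move=> e0; have [y1|y1] := leP (y ^+ 2) 1.
  rewrite ler_wpDr ?psi_ge0//.
  by rewrite ler_expR ler_piMr.
rewrite ler_wpDl ?expR_ge0// /psi ler_peMl ?expR_ge0//.
have -> : y ^+ 4 = (y ^+ 2) ^+ 2 by rewrite -exprM.
by rewrite exprn_ege1// ltW.
Qed.

End Gaussian.

(** * Dyadic chaining of a single path *)

Section Chaining.
Variables (R : realType) (T : R).
Hypothesis T0 : 0 < T.

Definition grid (n k : nat) : R := T * (k%:R / 2 ^+ n).

(* The weights sum to 1, and decay slowly enough for 2^n (T 2^-n / weight^2)^2
   to be summable. *)
Definition chain_weight (n : nat) : R := 10^-1 * (9 / 10) ^+ n.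

Lemma chain_weight_gt0 n : 0 < chain_weight n.
Proof. by rewrite mulr_gt0 ?exprn_gt0 ?invr_gt0// divr_gt0. Qed.

Lemma sum_chain_weight N : \sum_(n < N) chain_weight n < 1.
Proof.
suff -> : \sum_(n < N) chain_weight n = 1 - (9 / 10) ^+ N.
  by rewrite ltrBlDr ltrDl exprn_gt0// divr_gt0.
elim: N => [|N IH]; first by rewrite big_ord0 expr0 subrr.
by rewrite big_ord_recr/= IH /chain_weight exprS; field.
Qed.

Lemma grid_double n j : grid n.+1 j.*2 = grid n j.
Proof.
rewrite /grid -muln2 natrM exprS; congr (_ * _).
by rewrite [2 * _]mulrC -mulf_div divff// mulr1.
Qed.

Lemma gridSB n k : grid n k.+1 - grid n k = T / 2 ^+ n.
Proof. by rewrite /grid -natr1; ring. Qed.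

Lemma grid_ge0 n k : 0 <= grid n k.
Proof. by rewrite mulr_ge0 ?divr_ge0 ?exprn_ge0// ltW. Qed.

Lemma grid_le n k : (k <= 2 ^ n)%N -> grid n k <= T.
Proof.
move=> kn; rewrite /grid ler_piMr ?(ltW T0)// ler_pdivrMr ?exprn_gt0// mul1r.
by rewrite -natrX ler_nat.
Qed.

Lemma grid_lt n k : grid n k < grid n k.+1.
Proof. by rewrite -subr_gt0 gridSB divr_gt0// exprn_gt0. Qed.

Definition dyadic_incr (f : R -> R) n k := f (grid n k.+1) - f (grid n k).

(** Points of even index already lie on the coarser grid, and a point of odd index is one fine step
    to the right of such a point. Each level thus adds at most one increment to the chain. *)
Lemma chaining (f : R -> R) y N : 0 <= y ->
  (forall n k, (n <= N)%N -> (k < 2 ^ n)%N -> `|dyadic_incr f n k| <= y * chain_weight n) ->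
  forall k, (k <= 2 ^ N)%N -> `|f (grid N k) - f 0| <= y * \sum_(n < N.+1) chain_weight n.
Proof.
move=> y0; elim: N => [|N IH] H k kN.
  rewrite big_ord1; case: k kN => [|[|//]] _.
    by rewrite /grid mul0r mulr0 subrr normr0 mulr_ge0// ltW ?chain_weight_gt0.
  by have := H 0%N 0%N isT isT; rewrite /dyadic_incr {2}/grid mul0r mulr0.
have IH' := IH (fun n k nN => H n k (leqW nN)).
rewrite big_ord_recr/= mulrDr -(odd_double_half k) in kN *.
have kN' : (k./2 <= 2 ^ N)%N.
  by rewrite -leq_double -[(2 ^ N).*2]mul2n -expnS (leq_trans _ kN)// leq_addl.
have := IH' _ kN'; rewrite -grid_double.
case: (odd k) kN => /= kN; last first.
  by rewrite add0n => h; rewrite ler_wpDr// mulr_ge0// ltW ?chain_weight_gt0.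
rewrite add1n => h; have hk : ((k./2).*2 < 2 ^ N.+1)%N by rewrite add1n in kN.
rewrite (le_trans (ler_distD (f (grid N.+1 (k./2).*2)) _ _))// addrC lerD//.
exact: (H _ _ (leqnn _) hk).
Qed.

(* If every increment were small at every level, the chain would be too short
   to reach [f (grid N k)]. *)
Lemma chaining_exists (f : R -> R) N k : (k <= 2 ^ N)%N -> f (grid N k) != f 0 ->
  exists n j, (j < 2 ^ n)%N /\
  `|f (grid N k) - f 0| <= `|dyadic_incr f n j| / chain_weight n.
Proof.
move=> kN; rewrite -subr_eq0 -normr_gt0; set y := `|_| => y0; apply: contrapT => H.
have : y <= y * \sum_(n < N.+1) chain_weight n.
  apply: chaining (ltW y0) _ _ kN => n j _ jn; rewrite leNgt; apply/negP => yj.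
  apply: H; exists n, j; split => //.
  by rewrite ler_pdivlMr ?chain_weight_gt0// ltW.
by apply/negP; rewrite -ltNge gtr_pMr// sum_chain_weight.
Qed.

End Chaining.

Section BrownianSup.
Variables (R : realType) (d : measure_display) (Omega : measurableType d).
Variables (P : probability Omega R) (W : R -> Omega -> R) (T : R).
Hypothesis T0 : 0 < T.
Hypothesis mW : forall t, 0 <= t -> measurable_fun setT (W t).
Hypothesis cW : forall w, {within `[0, +oo[, continuous (fun t => W t w)}.
Hypothesis lawW : forall s t, 0 <= s -> s < t -> forall A, measurable A ->
  P ((fun w => W t w - W s w) @^-1` A) = normal_prob 0 (Num.sqrt (t - s)) A.

(* Chosen so that e * (T 2^-n / weight^2) <= 1/8 at every level n. *)
Let e : R := (8 * 10 ^+ 2 * T)^-1.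

Let e_gt0 : 0 < e. Proof. by rewrite invr_gt0 mulr_gt0// mulr_gt0// exprn_gt0. Qed.

Let incr n j w := dyadic_incr T (W ^~ w) n j.

Let measurable_incr n j : measurable_fun setT (incr n j).
Proof. by apply: measurable_funB; apply: mW; apply: grid_ge0. Qed.

Let term n j w := psi e (`|incr n j w| / chain_weight R n).

Let measurable_term n j : measurable_fun setT (term n j).
Proof.
have m1 : measurable_fun setT (fun w => `|incr n j w| / chain_weight R n).
  apply: measurable_funM => //; apply: measurableT_comp => //; exact: measurable_incr.
apply: measurable_funM; first exact: measurable_funX.
apply: measurableT_comp => //; apply: measurable_funM => //; exact: measurable_funX.
Qed.

(** The left side is the variance of a level-[n] increment divided by its weight; [50 / 81] is
    [1 / (2 * (9/10)^2)]. *)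
Let scale n : T / 2 ^+ n / chain_weight R n ^+ 2 = 10 ^+ 2 * T * (50 / 81) ^+ n.
Proof.
have -> : (50 / 81 : R) = (2 * (9 / 10) ^+ 2)^-1 by field.
have h1 : (9 / 10 : R) ^+ n != 0 by rewrite expf_neq0// lt0r_neq0// divr_gt0.
have h2 : (2 : R) ^+ n != 0 by rewrite expf_neq0.
rewrite /chain_weight exprVn [_ ^+ 2]exprMn -[(_ ^+ n) ^+ 2]exprM [(n * 2)%N]mulnC.
rewrite [(2 * _) ^+ n]exprMn -[(_ ^+ 2) ^+ n]exprM.
have h3 : (9 / 10 : R) ^+ (2 * n) != 0 by rewrite expf_neq0// lt0r_neq0// divr_gt0.
move: h2 h3; set A := 2 ^+ n; set B := _ ^+ (2 * n) => h2 h3.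
by field; rewrite h3 h2.
Qed.

(** [psi_scale_le] with [r] the normalised standard deviation and [z] the standardised increment
    contributes 128; the other factor 2 bounds [sqrt 2]. *)
Let integral_term n j :
  (\int[P]_w (term n j w)%:E <= (2 * 128 * (10 ^+ 2 * T * (50 / 81) ^+ n) ^+ 2)%:E)%E.
Proof.
have st : grid T n j < grid T n j.+1 by exact: grid_lt.
set s := Num.sqrt (grid T n j.+1 - grid T n j).
have s0 : 0 < s by rewrite sqrtr_gt0 subr_gt0.
have s2 : s ^+ 2 = T / 2 ^+ n.
  by rewrite sqr_sqrtr ?subr_ge0 ?(ltW st)// gridSB.
have w0 := chain_weight_gt0 R n.
have r2 : (s / chain_weight R n) ^+ 2 = 10 ^+ 2 * T * (50 / 81) ^+ n.
  by rewrite exprMn exprVn s2 scale.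
have rr : e * (s / chain_weight R n) ^+ 2 <= 8^-1.
  rewrite r2 /e.
  have -> : (8 * 10 ^+ 2 * T)^-1 * (10 ^+ 2 * T * (50 / 81) ^+ n) = 8^-1 * (50 / 81) ^+ n.
    by field; exact: lt0r_neq0.
  by rewrite ler_piMr// exprn_ile1//; lra.
have H w : term n j w <= 128 * (s / chain_weight R n) ^+ 4 * expR (incr n j w ^+ 2 / (4 * s ^+ 2)).
  have -> : incr n j w ^+ 2 / (4 * s ^+ 2) = (`|incr n j w| / s) ^+ 2 / 4.
    by rewrite exprMn real_normK ?num_real//; field; exact: lt0r_neq0.
  have := @psi_scale_le R e (s / chain_weight R n) (`|incr n j w| / s) (ltW e_gt0) _ rr.
  rewrite divr_ge0 ?(ltW s0) ?(ltW w0)// => /(_ isT).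
  rewrite /term; congr (psi _ _ <= _).
  by field; rewrite !lt0r_neq0.
have mE : measurable_fun setT (fun w => expR (incr n j w ^+ 2 / (4 * s ^+ 2))).
  apply: measurableT_comp => //; apply: measurable_funM => //; exact: measurable_funX.
apply: (@le_trans _ _ (\int[P]_w ((128 * (s / chain_weight R n) ^+ 4)%:E *
   (expR (incr n j w ^+ 2 / (4 * s ^+ 2)))%:E)))%E.
  apply: ge0_le_integral => //.
  - by move=> w _; rewrite lee_fin psi_ge0.
  - exact/measurable_EFinP.
  - by apply: emeasurable_funM => //; exact/measurable_EFinP.
  - by move=> w _; rewrite -EFinM lee_fin.
have r4 : (s / chain_weight R n) ^+ 4 = (10 ^+ 2 * T * (50 / 81) ^+ n) ^+ 2.
  by rewrite -r2 -exprM.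
rewrite ge0_integralZl//; [|exact/measurable_EFinP|by rewrite lee_fin r4 mulr_ge0 ?sqr_ge0].
rewrite (integral_gaussian_expR_sqr s0 (measurable_incr n j)); last first.
  by apply: lawW => //; apply: grid_ge0.
rewrite -EFinM lee_fin r4 mulrC -!mulrA ler_wpM2r//.
  by rewrite mulr_ge0// sqr_ge0.
rewrite -(@ler_pXn2r _ 2)// ?nnegrE ?sqrtr_ge0// sqr_sqrtr//.
by rewrite expr2; lra.
Qed.

(** A sum replaces the supremum of the terms: it dominates each of them, and its expectation is
    computed term by term. *)
Let Q w : \bar R := (\sum_(n <oo) \sum_(j < 2 ^ n) (term n j w)%:E)%E.

Let level_ge0 n w : (0 <= \sum_(j < 2 ^ n) (term n j w)%:E)%E.
Proof. by apply: sume_ge0 => j _; rewrite lee_fin psi_ge0. Qed.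

Let measurable_level n : measurable_fun setT (fun w => \sum_(j < 2 ^ n) (term n j w)%:E)%E.
Proof. by apply: emeasurable_sum => j; exact/measurable_EFinP. Qed.

Let measurable_Q : measurable_fun setT Q.
Proof. by apply: ge0_emeasurable_sum => // n w _ _; exact: level_ge0. Qed.

Let integral_Q : (\int[P]_w Q w < +oo)%E.
Proof.
rewrite integral_nneseries//.
(* Level [n] has [2 ^ n] terms, each of order [(50 / 81) ^ (2n)]; the series converges because the
   ratio [q = 5000 / 6561] is below 1. *)
pose c : R := 2 * 128 * (10 ^+ 2 * T) ^+ 2; pose q : R := 2 * (50 / 81) ^+ 2.
have c0 : 0 <= c by rewrite mulr_ge0 ?sqr_ge0.
have H n : (\int[P]_w (\sum_(j < 2 ^ n) (term n j w)%:E) <= (c * q ^+ n)%:E)%E.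
  rewrite ge0_integral_sum//; last first.
  - by move=> j w _; rewrite lee_fin psi_ge0.
  - by move=> j; exact/measurable_EFinP.
  apply: (@le_trans _ _ (\sum_(j < 2 ^ n) (2 * 128 * (10 ^+ 2 * T * (50 / 81) ^+ n) ^+ 2)%:E)%E).
    by apply: lee_sum => j _; exact: integral_term.
  rewrite sumEFin lee_fin sumr_const card_ord -[_ *+ (2 ^ n)%N]mulr_natl natrX.
  rewrite le_eqVlt; apply/orP; left; apply/eqP.
  rewrite /c /q [(2 * (50 / 81) ^+ 2) ^+ n]exprMn -[(_ ^+ 2) ^+ n]exprM [(2 * n)%N]mulnC exprM.
  ring.
apply: (@le_lt_trans _ _ (c / (1 - q))%:E); last exact: ltry.
apply: lime_le.
  apply: is_cvg_nneseries => n _ _; apply: integral_ge0 => w _; exact: level_ge0.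
apply: nearW => N; apply: (@le_trans _ _ (\sum_(0 <= n < N) (c * q ^+ n)%:E)%E).
  by apply: lee_sum => n _; exact: H.
rewrite sumEFin lee_fin -mulr_sumr ler_wpM2l//.
have q1 : 0 < 1 - q by rewrite /q; lra.
have := @geometric_seriesE R 1 q _; rewrite lt_eqF; last by rewrite -subr_gt0.
move=> /(_ isT)/(congr1 (fun f => f N)); rewrite /series/= /geometric/=.
under eq_bigr do rewrite mul1r.
move=> ->; rewrite mul1r ler_pdivrMr// mulVf ?lt0r_neq0// gerBl exprn_ge0//.
by rewrite /q mulr_ge0// sqr_ge0.
Qed.

(** Grid points of all levels are enumerated by one index, so that their supremum is that of a
    sequence of measurable functions. Codes that denote no grid point of [[0, T]] get the harmless
    value 0. *)
Let h (i : nat) w : R :=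
  if unpickle i is Some nk then
    if (nk.2 <= 2 ^ nk.1)%N then `|W (grid T nk.1 nk.2) w - W 0 w| else 0
  else 0.

Let measurable_h i : measurable_fun setT (h i).
Proof.
rewrite /h; case: unpickle => [[n k]|//] /=; case: (k <= 2 ^ n)%N => //.
by apply: measurableT_comp => //; apply: measurable_funB; apply: mW => //=; apply: grid_ge0.
Qed.

Let h_ge0 i w : 0 <= h i w.
Proof. by rewrite /h; case: unpickle => [[n k]|//]; case: ifPn. Qed.

(** Chaining bounds the displacement at a grid point by a single normalised increment; [psi] is
    monotone, and its value at that increment is one of the terms of [Q]. *)
Let psi_h i w : ((psi e (h i w))%:E <= Q w)%E.
Proof.
have psi0 : psi e 0 = 0 by rewrite /psi expr0n mul0r.
have Q0 : (0 <= Q w)%E by apply: nneseries_ge0 => n _ _; exact: level_ge0.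
rewrite /h; case: unpickle => [[n k]|]/=; last by rewrite psi0.
case: ifPn => [kn|_]; last by rewrite psi0.
have [->|neq] := eqVneq (W (grid T n k) w) (W 0 w); first by rewrite subrr normr0 psi0.
have [m [j [jm hj]]] := @chaining_exists R T (W ^~ w) n k kn neq.
apply: (@le_trans _ _ (term m j w)%:E).
  by rewrite lee_fin /term ler_psi// ltW.
apply: (@le_trans _ _ (\sum_(j < 2 ^ m) (term m j w)%:E)%E).
  rewrite (bigD1 (Ordinal jm))//= leeDl// sume_ge0// => ? _.
  by rewrite lee_fin psi_ge0.
apply: (@le_trans _ _ (\sum_(0 <= n < m.+1) \sum_(j < 2 ^ n) (term n j w)%:E)%E).
  rewrite big_nat_recr//= leeDr// sume_ge0// => ? _; exact: level_ge0.
apply: nneseries_lim_ge => ? _ _; exact: level_ge0.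
Qed.

Let cW0 w : {within `[0, T], continuous (W ^~ w)}.
Proof.
apply: continuous_subspaceW (cW (w := w)) => s /=.
by rewrite !in_itv/= => /andP[-> _].
Qed.

Let h_ub w : has_ubound (range (h ^~ w)).
Proof.
have [C C0 HC] := continuous_bounded_itv (@cW0 w).
exists (C + C) => _ [i _ <-]; rewrite /h; case: unpickle => [[n k]|]/=; last by rewrite addr_ge0.
case: ifPn => [kn|_]; last by rewrite addr_ge0.
rewrite (le_trans (ler_normB _ _))// lerD// HC//.
  by rewrite grid_ge0//= grid_le.
by rewrite lexx ltW.
Qed.

Let M w : R := sups (h ^~ w) 0.

Let h_le_M i w : h i w <= M w.
Proof.
apply: ub_le_sup; last by exists i.
have [C HC] := h_ub w; exists C => _ [j _ <-]; apply: HC; by exists j.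
Qed.

Let M_ge0 w : 0 <= M w.
Proof. exact: le_trans (h_ge0 0 w) (h_le_M 0 w). Qed.

(** By continuity of the path, exceeding [M] at [s] would force it to be exceeded at the grid point
    just to the left of [s] on a fine enough grid. *)
Let incr_le_M s w : 0 <= s <= T -> `|W s w - W 0 w| <= M w.
Proof.
move=> sT; rewrite leNgt; apply/negP => Ms.
have cs := continuous_comp_clamp (ltW T0) (@cW0 w).
have gap : 0 < `|W s w - W 0 w| - M w by rewrite subr_gt0.
have /cvgrPdist_lt/(_ _ gap) [r /= r0 Hr] := cs s.
have [n hn] : exists n, T / 2 ^+ n < r.
  exists (Num.bound (T / r)); rewrite ltr_pdivrMr ?exprn_gt0// mulrC -ltr_pdivrMr//.
  apply: (@lt_le_trans _ _ (Num.bound (T / r))%:R).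
    by apply: archi_boundP; rewrite divr_ge0 ?ltW.
  by rewrite -natrX ler_nat ltnW// ltn_expl.
pose k := Num.truncn (s * 2 ^+ n / T).
have s0 : 0 <= s by case/andP: sT.
have x0 : 0 <= s * 2 ^+ n / T by rewrite !mulr_ge0 ?exprn_ge0 ?invr_ge0 ?(ltW T0).
have /andP[k1 k2] := truncn_itv x0; rewrite -/k in k1 k2.
have gE : grid T n k = T * k%:R / 2 ^+ n by rewrite /grid mulrA.
have p2 : 0 < 2 ^+ n :> R by rewrite exprn_gt0.
have g1 : grid T n k <= s by rewrite gE ler_pdivrMr// mulrC -ler_pdivlMr.
have g2 : s < grid T n k.+1.
  by rewrite /grid mulrA ltr_pdivlMr// [T * _]mulrC -ltr_pdivrMr.
have kn : (k <= 2 ^ n)%N.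
  rewrite -(@ler_nat R) natrX (le_trans k1)// ler_pdivrMr// mulrC ler_pM2l//.
  by case/andP: sT.
have gT : 0 <= grid T n k <= T by rewrite grid_ge0//= grid_le.
have := Hr (grid T n k); rewrite /= !clamp_id//.
have -> : `|s - grid T n k| < r.
  rewrite ger0_norm ?subr_ge0//; apply: lt_trans hn.
  by rewrite -(gridSB T n k) ltrD2r.
move=> /(_ isT); apply/negP; rewrite -leNgt.
have hM : `|W (grid T n k) w - W 0 w| <= M w.
  by have := h_le_M (pickle (n, k)) w; rewrite /h pickleK /= kn.
rewrite lerBlDr (le_trans (ler_distD (W (grid T n k) w) _ _))//.
by rewrite lerD2l.
Qed.

Let expR_M w : ((expR (e / 4 * M w ^+ 2))%:E <= (expR e)%:E + Q w)%E.
Proof.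
(* The supremum need not be attained, but it is up to a factor 2; squaring this factor accounts for
   [e / 4]. *)
have [i hi] : exists i, M w <= 2 * h i w.
  have [M0|M0] := eqVneq (M w) 0; first by exists 0%N; rewrite M0 mulr_ge0.
  have Mp : 0 < M w by rewrite lt0r M0 M_ge0.
  have M2 : M w / 2 < M w by lra.
  have hs : has_sup (sdrop (h ^~ w) 0).
    split; first by exists (h 0 w); exists 0%N.
    by have [C HC] := h_ub w; exists C => _ [j _ <-]; apply: HC; exists j.
  have [_ [i _ <-] hi] := sup_adherent (divr_gt0 Mp (ltr0n R 2)) hs.
  have MS : M w = sup (sdrop (h ^~ w) 0) by [].
  by exists i; move: hi; rewrite -MS; lra.
apply: (@le_trans _ _ (expR e + psi e (h i w))%:E); last by rewrite EFinD leeD2l.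
rewrite lee_fin; apply: le_trans (expR_sqr_le_psi (h i w) (ltW e_gt0)).
rewrite ler_expR -mulrA ler_wpM2l ?(ltW e_gt0)//.
have : M w ^+ 2 <= (2 * h i w) ^+ 2 by rewrite lerXn2r ?nnegrE ?mulr_ge0.
by rewrite exprMn; lra.
Qed.

(** The displacement from [W 0] is what is bounded for every [w]: [W 0] vanishes only almost surely,
    while the equation sees [W] only through increments. *)
Lemma brownian_sup_expR_sqr : exists (eps : R) (S : Omega -> R),
  [/\ 0 < eps, measurable_fun setT S, forall w, 0 <= S w,
      forall w s, 0 <= s <= T -> `|W s w - W 0 w| <= S w &
      (\int[P]_w (expR (eps * S w ^+ 2))%:E < +oo)%E].
Proof.
exists (e / 4), M; split => //.
- by rewrite divr_gt0.
- apply: measurable_fun_sups => // w _; exact: h_ub.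
- by move=> w s; exact: incr_le_M.
apply: (@le_lt_trans _ _ (\int[P]_w ((expR e)%:E + Q w))%E).
  apply: ge0_le_integral => //.
  - apply/measurable_EFinP; apply: measurableT_comp => //; apply: measurable_funM => //.
    by apply: measurable_funX; apply: measurable_fun_sups => // w _; exact: h_ub.
  - by apply: emeasurable_funD.
rewrite ge0_integralD//; last first.
  by move=> w _; apply: nneseries_ge0 => n _ _; exact: level_ge0.
apply: lte_add_pinfty => //; rewrite integral_cst//=.
by rewrite [X in (_ * X)%E]probability_setT mule1 ltry.
Qed.

End BrownianSup.

(** * Regular random fields *)

Lemma is_derive_under_integral (R : realType) d (Y : measurableType d)
  (m : {measure set Y -> \bar R}) (B : set Y) (f f' : R -> Y -> R) (G : Y -> R) (x : R) :
  measurable B -> (forall y, m.-integrable B (EFin \o f y)) ->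
  (forall (y : R) s, B s -> is_derive y 1 (f ^~ s) (f' y s)) ->
  m.-integrable B (EFin \o G) -> (forall s, 0 <= G s) ->
  (forall (y : R) s, `|y - x| < 1 -> B s -> `|f' y s| <= G s) ->
  is_derive x 1 (fun y => \int[m]_(s in B) f y s) (\int[m]_(s in B) f' x s).
Proof.
move=> mB intf df iG G0 f'G.
have Ix : [set` `]x - 1, x + 1[] x by rewrite /= in_itv/= gtrBl ltrDl ltr01.
have d1 (y : R) s : B s -> partial1of2 f y s = f' y s.
  by move=> Bs; rewrite partial1of2E; have := df y s Bs => ?; rewrite derive_val.
have dG (y : R) s : [set` `]x - 1, x + 1[] y -> B s -> `|partial1of2 f y s| <= G s.
  move=> /= /[!in_itv]/= /andP[y1 y2] Bs; rewrite d1//; apply: f'G => //.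
  by rewrite ltr_norml; apply/andP; split; lra.
have df1 (y : R) s : [set` `]x - 1, x + 1[] y -> B s -> derivable (f ^~ s) y 1.
  by move=> _ Bs; have := df y s Bs.
have e1 : \int[m]_(s in B) f' x s = \int[m]_(s in B) partial1of2 f x s.
  by apply: eq_Rintegral => s; rewrite inE => Bs; rewrite d1.
rewrite e1; apply: DeriveDef.
  exact: (@derivable_under_integral R d Y m f B mB x (x - 1) (x + 1) Ix (fun y _ => intf y) df1 G G0 iG dG).
rewrite -derive1E.
exact: (@differentiation_under_integral R d Y m f B mB x (x - 1) (x + 1) Ix (fun y _ => intf y) df1 G G0 iG dG).
Qed.

Section Regular.
Variables (R : realType) (d : measure_display) (Omega : measurableType d) (M : Omega -> R).
Hypothesis M_ge0 : forall w, 0 <= M w.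
Implicit Types F G A B : R -> R -> Omega -> R.

(* Random fields (t, x, w) |-> F t x w dominated by a negligible power series
   in |x| + M w, where M has a Gaussian exponential moment. *)
Definition tame F := [/\ forall w, continuous (fun z : R * R => F z.1 z.2 w),
  forall t x, measurable_fun setT (F t x) &
  exists r : nat -> R, [/\ forall k, 0 <= r k, negl r &
    forall t x w, `|F t x w| <= pvalue r (`|x| + M w)]].

(** The derivative is carried as an explicit field, so that closure under products and exponentials
    becomes an induction on the depth. Smoothness is [regular n] for every [n]. *)
Fixpoint regular n F : Prop := tame F /\
  if n is n'.+1 then exists F',
    (forall t (x : R) w, is_derive x 1 (fun y => F t y w) (F' t x w)) /\ regular n' F'
  else True.

Lemma regular_tame n F : regular n F -> tame F.
Proof. by case: n => [|n] []. Qed.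

Lemma regularW n F : regular n.+1 F -> regular n F.
Proof.
elim: n F => [F [tF _]//|n IH F [tF [F' [dF /IH rF']]]].
by split => //; exists F'.
Qed.

Lemma tame_cst (g : R -> R) C : continuous g -> (forall t, `|g t| <= C) ->
  tame (fun t _ _ => g t).
Proof.
move=> cg gC; split=> [w z|t x|].
- by apply: (cvg_comp fst g); [exact: cvg_fst|exact: cg].
- exact: measurable_cst.
- exists (fun k => if k is 0%N then C else 0); split.
  + by case=> //; apply: le_trans (gC 0).
  + exact: negl_cst.
  + by move=> t x w; rewrite pvalue_cst.
Qed.

Lemma tameD F G : tame F -> tame G -> tame (fun t x w => F t x w + G t x w).
Proof.
move=> [cF mF [r [r0 nr Fr]]] [cG mG [s [s0 ns Gs]]]; split=> [w z|t x|].
- by apply: cvgD; [exact: cF|exact: cG].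
- exact: measurable_funD.
- exists (fun k => r k + s k); split.
  + by move=> k; rewrite addr_ge0.
  + exact: neglD.
  + by move=> t x w; rewrite pvalueD// (le_trans (ler_normD _ _))// lerD.
Qed.

Lemma tameM F G : tame F -> tame G -> tame (fun t x w => F t x w * G t x w).
Proof.
move=> [cF mF [r [r0 nr Fr]]] [cG mG [s [s0 ns Gs]]]; split=> [w z|t x|].
- by apply: cvgM; [exact: cF|exact: cG].
- exact: measurable_funM.
- exists (cauchy_prod r s); split.
  + by move=> k; apply: sumr_ge0 => i _; rewrite mulr_ge0.
  + exact: negl_cauchy_prod.
  + by move=> t x w; rewrite pvalue_cauchy_prod// normrM ler_pM.
Qed.

Lemma regular_cst n (g : R -> R) C : continuous g -> (forall t, `|g t| <= C) ->
  regular n (fun t _ _ => g t).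
Proof.
elim: n g C => [|n IH] g C cg gC; split => //; try exact: tame_cst gC.
exists (fun _ _ _ => 0); split; first by move=> t x w; exact: is_derive_cst.
by apply: (IH (fun=> 0) 0) => [t|t]; [exact: cvg_cst|rewrite normr0].
Qed.

Lemma regularD n F G : regular n F -> regular n G ->
  regular n (fun t x w => F t x w + G t x w).
Proof.
elim: n F G => [|n IH] F G [tF]; first by move=> _ [tG _]; split => //; exact: tameD.
move=> [F' [dF rF']] [tG [G' [dG rG']]]; split; first exact: tameD.
exists (fun t x w => F' t x w + G' t x w); split; last exact: IH.
by move=> t x w; have := dF t x w; have := dG t x w => ? ?; exact: is_deriveD.
Qed.

Lemma regularM n F G : regular n F -> regular n G ->
  regular n (fun t x w => F t x w * G t x w).
Proof.
elim: n F G => [|n IH] F G rF rG.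
  by split => //; apply: tameM; [exact: regular_tame rF|exact: regular_tame rG].
have [tF [F' [dF rF']]] := rF; have [tG [G' [dG rG']]] := rG.
split; first exact: tameM.
exists (fun t x w => F t x w * G' t x w + G t x w * F' t x w); split.
  by move=> t x w; have := dF t x w; have := dG t x w => ? ?; exact: is_deriveM.
by apply: regularD; apply: IH => //; exact: regularW.
Qed.

Lemma regularN n F : regular n F -> regular n (fun t x w => - F t x w).
Proof.
move=> rF; have := regularM (@regular_cst n (fun=> -1) 1 (fun=> cvg_cst _) _) rF.
rewrite (_ : (fun t x w => -1 * F t x w) = (fun t x w => - F t x w)).
  by apply; rewrite normrN1.
by apply/funext => t; apply/funext => x; apply/funext => w; rewrite mulN1r.
Qed.

(** * Real and imaginary parts of the complex exponential *)

Section ComplexExponential.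
Variables A B : R -> R -> Omega -> R.
Hypothesis A_le0 : forall t x w, A t x w <= 0.
Hypothesis rA : forall n, regular n A.
Hypothesis rB : forall n, regular n B.

Let EC t x w := expR (A t x w) * cos (B t x w).
Let ES t x w := expR (A t x w) * sin (B t x w).

Lemma tame_expR_trig : tame EC /\ tame ES.
Proof.
have [cA mA _] := regular_tame (rA 0); have [cB mB _] := regular_tame (rB 0).
have cE w : continuous (fun z : R * R => expR (A z.1 z.2 w)).
  by move=> z; apply: (cvg_comp _ expR (cA w z)); exact: continuous_expR.
have mE t x : measurable_fun setT (fun w => expR (A t x w)) by exact: measurableT_comp.
have E1 t x w : expR (A t x w) <= 1 by rewrite -expR0 ler_expR.
have bd (g : R -> R) : (forall y, `|g y| <= 1) -> exists r : nat -> R,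
    [/\ forall k, 0 <= r k, negl r &
     forall t x w, `|expR (A t x w) * g (B t x w)| <= pvalue r (`|x| + M w)].
  move=> g1; exists (fun k => if k is 0%N then 1 else 0); split.
  - by case.
  - exact: negl_cst.
  - move=> t x w; rewrite pvalue_cst normrM ger0_norm ?expR_ge0//.
    by rewrite mulr_ile1 ?expR_ge0.
split; split.
- move=> w z; apply: cvgM; first exact: cE.
  by apply: (cvg_comp _ cos (cB w z)); exact: continuous_cos.
- move=> t x; apply: measurable_funM => //.
  by apply: measurableT_comp => //; apply: continuous_measurable_fun; exact: continuous_cos.
- by apply: bd => y; exact: cos_max.
- move=> w z; apply: cvgM; first exact: cE.
  by apply: (cvg_comp _ sin (cB w z)); exact: continuous_sin.
- move=> t x; apply: measurable_funM => //.
  by apply: measurableT_comp => //; apply: continuous_measurable_fun; exact: continuous_sin.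
- by apply: bd => y; exact: sin_max.
Qed.

(** The derivative of each part involves both, so the induction treats the pair. Depth [n + 1] asks
    only for products of depth-[n] fields, since the parts themselves are tame, dominated by the
    constant series 1. *)
Lemma regular_expR_trig n : regular n EC /\ regular n ES.
Proof.
have [tC tS] := tame_expR_trig.
elim: n => [|n [IHC IHS]]; first by [].
have [_ [A' [dA rA']]] := rA n.+1; have [_ [B' [dB rB']]] := rB n.+1.
split; split => //.
- exists (fun t x w => EC t x w * A' t x w + - (ES t x w * B' t x w)); split.
    move=> t x w; have := dA t x w; have := dB t x w => ? ?.
    by apply: is_derive_eq; rewrite /EC /ES /GRing.scale/=; ring.
  by apply: regularD; [exact: regularM|apply: regularN; exact: regularM].
- exists (fun t x w => ES t x w * A' t x w + EC t x w * B' t x w); split.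
    move=> t x w; have := dA t x w; have := dB t x w => ? ?.
    by apply: is_derive_eq; rewrite /EC /ES /GRing.scale/=; ring.
  by apply: regularD; exact: regularM.
Qed.

End ComplexExponential.

(** * Differentiation under the expectation *)

Section Expectation.
Variable P : probability Omega R.
Hypothesis integrable_M : forall r : nat -> R, (forall k, 0 <= r k) -> negl r ->
  P.-integrable setT (EFin \o (fun w => pvalue r (M w))).

Definition expect F (t x : R) : R := \int[P]_w F t x w.

Lemma tame_dominated F X : 0 <= X -> tame F -> exists G : Omega -> R,
  [/\ P.-integrable setT (EFin \o G), forall w, 0 <= G w &
    forall t x w, `|x| <= X -> `|F t x w| <= G w].
Proof.
move=> X0 [_ _ [r [r0 nr Fr]]].
(* Coefficients of [x] mapped to [r (2 x)]; the factor [1] fits the shape of [neglZ] and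
   [pvalueZ]. *)
pose r2 := fun k => 1 * (2 ^+ k * r k).
have r20 k : 0 <= r2 k by rewrite /r2 mul1r mulr_ge0// exprn_ge0.
have nr2 : negl r2 by exact: neglZ.
exists (fun w => pvalue r (2 * X) + pvalue r2 (M w)); split.
- rewrite (_ : _ \o _ = (fun w => (pvalue r (2 * X))%:E + (pvalue r2 (M w))%:E)%E)//.
  apply: integrableD => //; first exact: finite_measure_integrable_cst.
  exact: integrable_M.
- by move=> w; rewrite addr_ge0// pvalue_ge0// mulr_ge0.
- move=> t x w xX; rewrite (le_trans (Fr t x w))//.
  apply: (@le_trans _ _ (pvalue r (X + M w))).
    by apply: ler_pvalue => //; [rewrite addr_ge0|rewrite lerD2r|move=> k; rewrite r0 /=].
  by rewrite /r2 pvalueZ// mul1r pvalue_add_le.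
Qed.

Lemma tame_integrable F t x : tame F -> P.-integrable setT (EFin \o F t x).
Proof.
move=> tF; have [G [iG G0 FG]] := tame_dominated (normr_ge0 x) tF.
have [_ mF _] := tF; apply: le_integrable iG => //; first exact/measurable_EFinP.
by move=> w _ /=; rewrite lee_fin (ger0_norm (G0 w)) FG.
Qed.

Lemma tame_expect_continuous F : tame F ->
  continuous (fun z : R * R => expect F z.1 z.2).
Proof.
move=> tF z; have [cF mF _] := tF.
have [G [iG G0 FG]] := tame_dominated (addr_ge0 (normr_ge0 z.2) ler01) tF.
apply: (@continuous_under_integral_seq R d Omega P (R * R)%type (fun v w => F v.1 v.2 w) setT z G) => //.
- by move=> w _; exact: cF.
- have : \forall y \near z.2, `|y| <= `|z.2| + 1.
    exists 1 => //= y /=; rewrite distrC => yz; have := ler_distD z.2 y 0; rewrite !subr0; lra.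
  move=> h; have hz : nbhs z [set v : R * R | `|v.2| <= `|z.2| + 1].
    by exists (setT, [set y | `|y| <= `|z.2| + 1]); [split; [exact: filterT|exact: h]|move=> v []].
  by apply: filterS hz => v hv w _; exact: FG.
Qed.

Lemma tame_expect_bound F : tame F -> exists (r : nat -> R) (C : R),
  [/\ forall k, 0 <= r k, negl r & forall t x, `|expect F t x| <= pvalue r `|x| + C].
Proof.
move=> tF; have [_ mF [r [r0 nr Fr]]] := tF.
pose r2 := fun k => 1 * (2 ^+ k * r k).
have r20 k : 0 <= r2 k by rewrite /r2 mul1r mulr_ge0// exprn_ge0.
have nr2 : negl r2 by exact: neglZ.
have i2 := integrable_M r20 nr2.
exists r2, (\int[P]_w pvalue r2 (M w)); split => // t x.
have iF := @tame_integrable F t x tF.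
apply: (le_trans (le_normr_Rintegral measurableT iF)).
have ic : P.-integrable setT (EFin \o (fun=> pvalue r2 `|x|) : Omega -> \bar R).
  exact: finite_measure_integrable_cst.
have -> : pvalue r2 `|x| = \int[P]_w pvalue r2 `|x|.
  by rewrite Rintegral_cst//= [X in fine X]probability_setT mulr1.
rewrite -RintegralD//; apply: le_Rintegral => //.
- exact: integrable_norm.
- by rewrite (_ : _ \o _ = (fun w => (pvalue r2 `|x|)%:E + (pvalue r2 (M w))%:E)%E)//;
    apply: integrableD.
- move=> w _; apply: (le_trans (Fr t x w)).
  by rewrite /r2 !pvalueZ// !mul1r pvalue_add_le.
Qed.

Lemma regular_expect_derive F F' : tame F -> tame F' ->
  (forall t (x : R) w, is_derive x 1 (fun y => F t y w) (F' t x w)) ->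
  forall t (x : R), is_derive x 1 (expect F t) (expect F' t x).
Proof.
move=> tF tF' dF t x.
have [G [iG G0 FG]] := tame_dominated (addr_ge0 (normr_ge0 x) ler01) tF'.
apply: (@is_derive_under_integral R d Omega P setT (F t) (F' t) G x) => //.
- by move=> y; exact: tame_integrable.
- move=> y w yx _; apply: FG; have := ler_distD x y 0; rewrite !subr0; lra.
Qed.

(** Each derivative uses up one level of regularity, and the resulting field [G] serves all [t] at
    once. *)
Lemma regular_expect_derive1n k n F : regular (n + k) F ->
  exists G, regular n G /\ forall t, derive1n k (expect F t) = expect G t.
Proof.
elim: k n F => [|k IH] n F; first by rewrite addn0 => rF; exists F.
rewrite -addSnnS => /IH[G [[tG [G' [dG rG']]] FG]]; exists G'; split => // t.
rewrite derive1nS FG; apply/funext => x; rewrite derive1E.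
have := regular_expect_derive tG (regular_tame rG') dG t x => ?.
by rewrite derive_val.
Qed.

Lemma regular_expect_smooth F : (forall n, regular n F) ->
  [/\ forall k t (x : R), derivable (derive1n k (expect F t)) x 1,
      forall k, continuous (fun z : R * R => derive1n k (expect F z.1) z.2) &
      forall k, exists (r : nat -> R) (C : R), [/\ forall j, 0 <= r j, negl r &
        forall t x, `|derive1n k (expect F t) x| <= pvalue r `|x| + C]].
Proof.
move=> rF; split.
- move=> k t x; have [G [[tG [G' [dG rG']]] FG]] := @regular_expect_derive1n k 1 F (rF _).
  rewrite FG; have := regular_expect_derive tG rG'.1 dG t x => ?.
  exact: ex_derive.
- move=> k; have [G [rG FG]] := @regular_expect_derive1n k 0 F (rF _).
  rewrite (_ : (fun z : R * R => _) = (fun z : R * R => expect G z.1 z.2)).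
    exact: tame_expect_continuous (regular_tame rG).
  by apply/funext => z; rewrite FG.
- move=> k; have [G [rG FG]] := @regular_expect_derive1n k 0 F (rF _).
  have [r [C [r0 nr H]]] := tame_expect_bound (regular_tame rG).
  by exists r, C; split => // t x; rewrite FG.
Qed.

End Expectation.

End Regular.

(** * The exponent as a random field *)

Section Kernel.
Variables (R : realType) (d : measure_display) (Omega : measurableType d) (M : Omega -> R).
Hypothesis M_ge0 : forall w, 0 <= M w.
Variables (T b : R) (U : R -> Omega -> R).
Hypothesis T0 : 0 < T.
Hypothesis cU : forall w, continuous (U ^~ w).
Hypothesis mU : forall s, measurable_fun setT (U s).
Hypothesis UM : forall s w, `|U s w| <= M w.
Notation mu := (@lebesgue_measure R).

(** On [[0, T]] this is [exp (b (s - t))]; the clamps bound it by [exp (|b| T)] for all real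
    times. *)
Definition flow (s t : R) : R := expR (b * (clamp 0 T s - clamp 0 T t)).

(* The process started at (t, x) is U s + flow s t * (x - U t); every
   x-derivative of u s * r (that process) has this form. *)
Definition kernel (u : R -> R) (j : nat) (r : nat -> R) (s t x : R) (w : Omega) : R :=
  u s * flow s t ^+ j * pvalue r (U s w + flow s t * (x - U t w)).

Lemma flow_ge0 s t : 0 <= flow s t.
Proof. exact: expR_ge0. Qed.

Lemma flow_le s t : flow s t <= expR (`|b| * T).
Proof.
rewrite ler_expR (le_trans (ler_norm _))// normrM ler_wpM2l//.
have /andP[s0 sT] := clamp_in s (ltW T0); have /andP[t0 tT] := clamp_in t (ltW T0).
by rewrite ler_norml; apply/andP; split; lra.
Qed.

Lemma continuous_flow (V : topologicalType) (f g : V -> R) (z : V) :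
  f @ z --> f z -> g @ z --> g z -> (fun v => flow (f v) (g v)) @ z --> flow (f z) (g z).
Proof.
move=> cf cg; apply: (cvg_comp (fun v => b * (clamp 0 T (f v) - clamp 0 T (g v))) expR);
  last exact: continuous_expR.
apply: cvgM; first exact: cvg_cst.
by apply: cvgB; [apply: (cvg_comp f (clamp 0 T) cf)|apply: (cvg_comp g (clamp 0 T) cg)];
  exact: continuous_clamp.
Qed.

Lemma continuous_kernel (V : topologicalType) (u : R -> R) j (r : nat -> R) (f g h : V -> R) (z : V) w :
  continuous u -> negl r ->
  f @ z --> f z -> g @ z --> g z -> h @ z --> h z ->
  (fun v => kernel u j r (f v) (g v) (h v) w) @ z --> kernel u j r (f z) (g z) (h z) w.
Proof.
move=> cu nr cf cg ch; have cfl := continuous_flow cf cg.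
apply: cvgM.
  apply: cvgM; first by apply: (cvg_comp f u); [exact: cf|exact: cu].
  apply: (cvg_comp _ (fun y => y ^+ j) cfl); exact: exprn_continuous.
apply: (cvg_comp (fun v => U (f v) w + flow (f v) (g v) * (h v - U (g v) w)) (pvalue r));
  last exact: continuous_pvalue.
apply: cvgD; first by apply: (cvg_comp f (U ^~ w)); [exact: cf|exact: cU].
apply: cvgM => //; apply: cvgB => //.
by apply: (cvg_comp g (U ^~ w)); [exact: cg|exact: cU].
Qed.

Lemma measurable_kernel u j r s t x : negl r -> measurable_fun setT (kernel u j r s t x).
Proof.
move=> nr; apply: measurable_funM => //; apply: measurableT_comp.
  by apply: continuous_measurable_fun; exact: continuous_pvalue.
apply: measurable_funD => //; apply: measurable_funM => //; exact: measurable_funB.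
Qed.

Lemma is_derive_kernel u j r s t (x : R) w : negl r ->
  is_derive x 1 (fun y => kernel u j r s t y w) (kernel u j.+1 (pseries_diffs r) s t x w).
Proof.
move=> nr; rewrite /kernel.
pose a (y : R) : R := U s w + flow s t * (y - U t w).
have da : is_derive x 1 a (flow s t).
  by apply: is_derive_eq; rewrite /GRing.scale/=; ring.
have dp := is_derive_pvalue (a x) nr.
have dc : is_derive x 1 (pvalue r \o a) (pvalue (pseries_diffs r) (a x) * flow s t).
  exact: is_derive1_comp.
have := is_deriveZ (u s * flow s t ^+ j) dc.
move=> dk; apply: (is_derive_eq dk).
by rewrite /a /GRing.scale/= exprSr; ring.
Qed.

Lemma kernel_bound u C j r : (forall s, `|u s| <= C) -> negl r ->
  exists r' : nat -> R, [/\ forall k, 0 <= r' k, negl r' &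
    forall s t x w, `|kernel u j r s t x w| <= pvalue r' (`|x| + M w)].
Proof.
move=> uC nr; set E := expR (`|b| * T).
have E0 : 0 <= E by exact: expR_ge0.
have C0 : 0 <= C by apply: le_trans (uC 0).
have nr' := negl_pabs nr.
(* With the flow at most [E], the argument of the series is at most [M + E (|x| + M)], hence at most
   [(1 + E) (|x| + M)]: this is the dilation. [C * E ^+ j] bounds the prefactor. *)
exists (fun k => C * E ^+ j * ((1 + E) ^+ k * pabs r k)); split.
- move=> k; apply: mulr_ge0; first by apply: mulr_ge0 => //; exact: exprn_ge0.
  by apply: mulr_ge0; [apply: exprn_ge0; exact: addr_ge0|exact: normr_ge0].
- exact: neglZ.
- move=> s t x w; rewrite pvalueZ// /kernel 2!normrM ler_pM// ?mulr_ge0//.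
    rewrite normrX (ger0_norm (flow_ge0 s t)).
    apply: ler_pM; [exact: normr_ge0|exact/exprn_ge0/flow_ge0|exact: uC|].
    apply: lerXn2r; last exact: flow_le.
      by rewrite nnegrE; exact: flow_ge0.
    by rewrite nnegrE; exact: E0.
  apply: le_trans (ler_norm_pvalue _ nr) _.
  apply: ler_pvalue => //; last by move=> k; rewrite normr_ge0 lexx.
  rewrite (le_trans (ler_normD _ _))// mulrDl mul1r lerD//.
    by rewrite (le_trans (UM s w))// lerDr.
  rewrite normrM ger0_norm ?flow_ge0// ler_pM ?flow_ge0//; first exact: flow_le.
  by rewrite (le_trans (ler_normB _ _))// lerD2l.
Qed.

Lemma regular_kernel n u C j r (f g : R -> R) : continuous u -> (forall s, `|u s| <= C) ->
  negl r -> continuous f -> continuous g ->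
  regular M n (fun t x w => kernel u j r (f t) (g t) x w).
Proof.
move=> cu uC nr cf cg; elim: n j r nr => [|n IH] j r nr.
  split => //; split=> [w z|t x|].
  - apply: (@continuous_kernel (R * R)%type u j r (fun z => f z.1) (fun z => g z.1) snd) => //.
    + by apply: (cvg_comp fst f); [exact: cvg_fst|exact: cf].
    + by apply: (cvg_comp fst g); [exact: cvg_fst|exact: cg].
    + exact: cvg_snd.
  - exact: measurable_kernel.
  - have [r' [r0 nr' H]] := kernel_bound j uC nr.
    by exists r'; split => // t x w; exact: H.
split; first exact: (regular_tame (IH j r nr)).
exists (fun t x w => kernel u j.+1 (pseries_diffs r) (f t) (g t) x w); split.
  by move=> t x w; exact: is_derive_kernel.
exact/IH/negl_diffs.
Qed.

(* [Num.max s t] freezes the integrand on [0, t], so that the domain of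
   integration does not depend on t. *)
Definition ikernel u j r (t x : R) w : R :=
  \int[mu]_(s in `[0, T]) kernel u j r (Num.max s t) t x w.

Lemma continuous_kernel_time u j r t x w : continuous u -> negl r ->
  continuous (fun s => kernel u j r (Num.max s t) t x w).
Proof.
move=> cu nr s; apply: (@continuous_kernel R u j r (fun s => Num.max s t) (fun=> t) (fun=> x)) => //.
- by apply: (@continuous_max R R id (fun=> t)); [exact: cvg_id|exact: cvg_cst].
- exact: cvg_cst.
- exact: cvg_cst.
Qed.

Lemma integral_kernel_const C : \int[mu]_(s in `[0, T]) C = T * C.
Proof.
transitivity (C * fine (mu `[0, T])); first exact: Rintegral_cst.
by rewrite lebesgue_measure_itv/= lte_fin T0 -EFinB/= subr0 mulrC.
Qed.

Lemma integrable_cst_itv (C : R) : mu.-integrable `[0, T] (EFin \o (fun=> C)).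
Proof. by apply: continuous_integrable_itv => s; exact: cvg_cst. Qed.

(** The majorant of [kernel_bound] is uniform in [s]. For [x] in a unit neighbourhood it therefore
    gives a constant dominating the integrand on [[0, T]], both for continuity and for
    differentiation. *)
Lemma regular_ikernel n u C j r (g : R -> R) : continuous u -> (forall s, `|u s| <= C) ->
  negl r -> continuous g ->
  regular M n (fun t x w => ikernel u j r (g t) x w).
Proof.
move=> cu uC nr cg; elim: n j r nr => [|n IH] j r nr.
  have [r' [r0 nr' H]] := kernel_bound j uC nr.
  split => //; split=> [w z|t x|].
  - apply: (@continuous_under_integral_seq R _ _ mu (R * R)%type
      (fun v s => kernel u j r (Num.max s (g v.1)) (g v.1) v.2 w) `[0, T]%classic z
      (fun=> pvalue r' (`|z.2| + 1 + M w))) => //.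
    + move=> v; apply: measurable_funTS; apply: continuous_measurable_fun.
      exact: continuous_kernel_time.
    + move=> s _.
      have cg1 : (fun v : R * R => g v.1) @ z --> g z.1.
        by apply: (cvg_comp fst g); [exact: cvg_fst|exact: cg].
      apply: (@continuous_kernel (R * R)%type u j r (fun v => Num.max s (g v.1)) (fun v => g v.1) snd) => //.
        by apply: (@continuous_max R (R * R)%type (fun=> s)) => //; exact: cvg_cst.
      exact: cvg_snd.
    + exact: integrable_cst_itv.
    + have : \forall y \near z.2, `|y| <= `|z.2| + 1.
        exists 1 => //= y /=; rewrite distrC => yz; have := ler_distD z.2 y 0; rewrite !subr0; lra.
      move=> h; have hz : nbhs z [set v : R * R | `|v.2| <= `|z.2| + 1].
        by exists (setT, [set y | `|y| <= `|z.2| + 1]); [split; [exact: filterT|exact: h]|move=> v []].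
      apply: filterS hz => v hv s _; rewrite (le_trans (H _ _ _ _))//.
      apply: ler_pvalue => //; first by rewrite addr_ge0.
        by rewrite lerD2r.
      by move=> k; rewrite r0 /=.
  - apply: measurable_Rintegral_itv; first exact: ltW.
      by move=> w; exact: continuous_kernel_time.
    by move=> s; exact: measurable_kernel.
  - exists (fun k => T * (1 ^+ k * r' k)); split.
    + by move=> k; rewrite expr1n mul1r mulr_ge0// ltW.
    + exact: neglZ.
    + move=> t x w; rewrite pvalueZ// mul1r -integral_kernel_const.
      have ik := continuous_integrable_itv 0 T (@continuous_kernel_time u j r (g t) x w cu nr).
      apply: (le_trans (le_normr_Rintegral _ ik)) => //.
      apply: le_Rintegral => //; first exact: integrable_norm.
      exact: integrable_cst_itv.
split; first exact: (regular_tame (IH j r nr)).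
exists (fun t x w => ikernel u j.+1 (pseries_diffs r) (g t) x w); split; last exact/IH/negl_diffs.
move=> t x w; have [r' [r0 nr' H]] := kernel_bound j.+1 uC (negl_diffs nr).
apply: (@is_derive_under_integral R _ _ mu `[0, T]%classic
  (fun y s => kernel u j r (Num.max s (g t)) (g t) y w)
  (fun y s => kernel u j.+1 (pseries_diffs r) (Num.max s (g t)) (g t) y w)
  (fun=> pvalue r' (`|x| + 1 + M w))) => //.
- by move=> y; apply: continuous_integrable_itv; exact: continuous_kernel_time.
- by move=> y s _; exact: is_derive_kernel.
- exact: integrable_cst_itv.
- by move=> _; rewrite pvalue_ge0// !addr_ge0.
- move=> y s yx _; rewrite (le_trans (H _ _ _ _))//.
  apply: ler_pvalue => //; first by rewrite addr_ge0.
    rewrite lerD2r; have := ler_distD x y 0; rewrite !subr0; lra.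
  by move=> k; rewrite r0 /=.
Qed.

Lemma ikernelE u j r t x w : continuous u -> negl r -> 0 <= t <= T ->
  \int[mu]_(s in `[t, T]) kernel u j r s t x w = ikernel u j r t x w - t * kernel u j r t t x w.
Proof.
move=> cu nr /andP[t0 tT]; have ck := @continuous_kernel_time u j r t x w cu nr.
rewrite /ikernel (Rintegral_itv_split ck t0 tT).
have -> : \int[mu]_(s in `[0, t]) kernel u j r (Num.max s t) t x w = t * kernel u j r t t x w.
  transitivity (\int[mu]_(s in `[0, t]) kernel u j r t t x w).
    apply: eq_Rintegral => s; rewrite inE/= in_itv/= => /andP[_ st].
    by rewrite max_r.
  transitivity (kernel u j r t t x w * fine (mu `[0, t])); first exact: Rintegral_cst.
  rewrite lebesgue_measure_itv/= lte_fin mulrC; case: ltP => [_|t0'] /=; first by rewrite subr0.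
  by rewrite (@le_anti _ _ t 0) ?t0 ?t0' ?mul0r.
rewrite addrAC subrr add0r; apply: eq_Rintegral => s; rewrite inE/= in_itv/= => /andP[ts _].
by rewrite max_l.
Qed.

Section Exponent.
Variables (u1 u2 u3 v : R -> R) (p1 p2 p3 q : nat -> R).
Hypothesis cu1 : {within `[0, T], continuous u1}.
Hypothesis cu2 : {within `[0, T], continuous u2}.
Hypothesis cu3 : {within `[0, T], continuous u3}.
Hypothesis np1 : negl p1.
Hypothesis np2 : negl p2.
Hypothesis np3 : negl p3.
Hypothesis nq : negl q.

Let cl (u : R -> R) s := u (clamp 0 T s).

Let part u r t x w := ikernel (cl u) 0 r t x w - t * kernel (cl u) 0 r t t x w.

(* Clamping t makes the field continuous and tame for all real t. *)
Definition exponent_field (t x : R) (w : Omega) : R :=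
  let t' := clamp 0 T t in
  part u1 p1 t' x w + part u2 p2 t' x w + part u3 p3 t' x w +
  kernel (fun=> v T) 0 q T t' x w.

Let regular_part n u r : {within `[0, T], continuous u} -> negl r ->
  regular M n (fun t x w => part u r (clamp 0 T t) x w).
Proof.
move=> cu nr; have cc := continuous_comp_clamp (ltW T0) cu.
have [C C0 HC] := continuous_bounded_itv cu.
have ub s : `|cl u s| <= C by apply: HC; exact: clamp_in (ltW T0).
have cT := @continuous_clamp R 0 T.
have rg : regular M n (fun t _ _ => clamp 0 T t).
  apply: (@regular_cst R d Omega M n (clamp 0 T) T) => // t.
  by have /andP[t0 tT] := clamp_in t (ltW T0); rewrite ger0_norm.
apply: regularD => //; first by apply: regular_ikernel; [exact: cc|exact: ub|exact: nr|exact: cT].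
have rk : regular M n (fun t x w => kernel (cl u) 0 r (clamp 0 T t) (clamp 0 T t) x w).
  by apply: regular_kernel; [exact: cc|exact: ub|exact: nr|exact: cT|exact: cT].
exact: regularN (regularM rg rk).
Qed.

Lemma regular_exponent n : regular M n exponent_field.
Proof.
have rq : regular M n (fun t x w => kernel (fun=> v T) 0 q T (clamp 0 T t) x w).
  apply: (@regular_kernel n (fun=> v T) `|v T| 0 q (fun=> T) (clamp 0 T)) => //.
  - by move=> ?; exact: cvg_cst.
  - by move=> ?; exact: cvg_cst.
  - exact: continuous_clamp.
have r12 := regularD (regular_part n cu1 np1) (regular_part n cu2 np2).
exact: (regularD (regularD r12 (regular_part n cu3 np3)) rq).
Qed.

Lemma exponent_fieldE t x w (X : R -> R) : 0 <= t <= T ->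
  (forall s, t <= s <= T -> X s = U s w + expR (b * (s - t)) * (x - U t w)) ->
  exponent_part T t u1 u2 u3 v p1 p2 p3 q X = exponent_field t x w.
Proof.
move=> tT XE; have /andP[t0 tT'] := tT.
rewrite /exponent_field clamp_id//.
have kE (u : R -> R) r s : t <= s <= T -> u s * pvalue r (X s) = kernel (cl u) 0 r s t x w.
  move=> /[dup] tsT /andP[ts sT]; rewrite /kernel /cl /flow expr0 mulr1 XE//.
  by rewrite !clamp_id// sT (le_trans t0 ts).
congr (_ + _); last first.
  rewrite /kernel expr0 mulr1 XE ?lexx ?tT'//.
  by rewrite /flow !clamp_id// lexx ltW.
have cT u : {within `[0, T], continuous u} -> continuous (cl u).
  exact: continuous_comp_clamp (ltW T0).
have ck u r : {within `[0, T], continuous u} -> negl r ->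
    continuous (fun s => kernel (cl u) 0 r s t x w).
  move=> cu nr s; apply: (@continuous_kernel R (cl u) 0 r id (fun=> t) (fun=> x)).
  - exact: cT.
  - exact: nr.
  - exact: cvg_id.
  - exact: cvg_cst.
  - exact: cvg_cst.
have c12 : continuous (fun s => kernel (cl u1) 0 p1 s t x w + kernel (cl u2) 0 p2 s t x w).
  by move=> s; apply: cvgD; exact: ck.
pose k u r s := kernel (cl u) 0 r s t x w.
have pE u r : {within `[0, T], continuous u} -> negl r ->
    part u r t x w = \int[mu]_(s in `[t, T]) k u r s.
  by move=> cu nr; apply/esym; exact: ikernelE (cT _ cu) nr tT.
rewrite (pE _ _ cu1 np1) (pE _ _ cu2 np2) (pE _ _ cu3 np3).
have i1 := continuous_integrable_itv t T (ck _ _ cu1 np1).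
have i2 := continuous_integrable_itv t T (ck _ _ cu2 np2).
have i3 := continuous_integrable_itv t T (ck _ _ cu3 np3).
have i12 := continuous_integrable_itv t T c12.
rewrite -(@RintegralD _ _ _ mu `[t, T]%classic (k u1 p1) (k u2 p2))//.
rewrite -(@RintegralD _ _ _ mu `[t, T]%classic (fun s => k u1 p1 s + k u2 p2 s) (k u3 p3))//.
apply: eq_Rintegral => s; rewrite inE/= in_itv/= => tsT.
by rewrite !kE.
Qed.

(** Carries properties of the exponent, in particular its sign, from [[0, T]] over to all real
    [t]. *)
Lemma exponent_field_clamp t x w : exponent_field (clamp 0 T t) x w = exponent_field t x w.
Proof. by rewrite /exponent_field (clamp_id (clamp_in t (ltW T0))). Qed.

End Exponent.

End Kernel.

(** * Solutions of the linear equation *)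

Section Solution.
Variables (R : realType) (a b c T : R).
Notation mu := (@lebesgue_measure R).

Definition solves (beta : R -> R) (t x : R) (X : R -> R) :=
  {within `[t, T], continuous X} /\
  forall s, t <= s <= T ->
    X s = x + \int[mu]_(r in `[t, s]) (a + b * X r) + c * (beta s - beta t).

Lemma Rintegral_cst_itv (k t s : R) : t <= s -> \int[mu]_(r in `[t, s]) k = k * (s - t).
Proof.
move=> ts; transitivity (k * fine (mu `[t, s])); first exact: Rintegral_cst.
rewrite lebesgue_measure_itv/= lte_fin; case: ltP => [//|st] /=.
by have -> : s = t; [apply/le_anti; rewrite ts st|rewrite subrr].
Qed.

Lemma solvesE beta t x X : t <= T -> solves beta t x X ->
  forall s, t <= s <= T -> X (clamp t T s) =
    x + a * (s - t) + c * (beta s - beta t) + b * \int[mu]_(r in `[t, s]) X (clamp t T r).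
Proof.
move=> tT [cX HX] s /[dup] tsT /andP[ts sT].
have cXc := continuous_comp_clamp tT cX.
rewrite clamp_id// HX//.
have -> : \int[mu]_(r in `[t, s]) (a + b * X r) =
    \int[mu]_(r in `[t, s]) (a + b * X (clamp t T r)).
  apply: eq_Rintegral => r; rewrite inE/= in_itv/= => /andP[tr rs].
  by rewrite clamp_id// tr (le_trans rs).
rewrite (@RintegralD _ _ _ mu `[t, s]%classic (fun=> a) (fun r => b * X (clamp t T r)))//.
- rewrite Rintegral_cst_itv// RintegralZl//; first by ring.
  exact: continuous_integrable_itv.
- by apply: continuous_integrable_itv; exact: cst_continuous.
- by apply: continuous_integrable_itv => r; apply: cvgM; [exact: cvg_cst|exact: cXc].
Qed.

(** Noise and constant drift cancel in the difference of two solutions, which solves the homogeneous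
    equation on [[t, T]]. *)
Lemma solves_flow beta t x X U : 0 <= t <= T -> solves beta 0 0 U -> solves beta t x X ->
  forall s, t <= s <= T -> X s = U s + expR (b * (s - t)) * (x - U t).
Proof.
move=> /andP[t0 tT] sU sX s tsT; have T0 := le_trans t0 tT.
have cX := continuous_comp_clamp tT sX.1; have cU := continuous_comp_clamp T0 sU.1.
have clU r : t <= r <= T -> clamp 0 T r = r.
  by move=> /andP[tr rT]; rewrite clamp_id// rT (le_trans t0).
pose D r := X (clamp t T r) - U (clamp 0 T r).
have cD : continuous D by move=> r; apply: cvgB; [exact: cX|exact: cU].
have HD r : t <= r <= T -> D r = (x - U t) + b * \int[mu]_(r in `[t, r]) D r.
  move=> /[dup] trT /andP[tr rT].
  have r0 : 0 <= r <= T by rewrite rT (le_trans t0).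
  have := solvesE tT sX trT; have := solvesE T0 sU r0.
  have := solvesE T0 sU (_ : 0 <= t <= T); rewrite t0 tT => /(_ isT).
  rewrite (Rintegral_itv_split cU t0 tr) /D.
  have -> : \int[mu]_(r in `[t, r]) (X (clamp t T r) - U (clamp 0 T r)) =
     \int[mu]_(r in `[t, r]) X (clamp t T r) - \int[mu]_(r in `[t, r]) U (clamp 0 T r).
    by apply: RintegralB => //; exact: continuous_integrable_itv.
  rewrite [clamp 0 T t]clU ?lexx//= => -> -> ->; ring.
have := linear_integral_eq_cst cD HD tsT.
by rewrite /D clamp_id// clU// => <-; rewrite subrKC.
Qed.

(* The solution started at (0, 0) when b = 0. *)
Definition noise (beta : R -> R) (s : R) : R :=
  a * clamp 0 T s + c * (beta (clamp 0 T s) - beta 0).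

(** Variation of constants after integration by parts: only values of the path occur. Both the
    measurability in [w] and the affine bound are read off from this formula. *)
Lemma solves_explicit beta U : 0 <= T -> {within `[0, T], continuous beta} ->
  solves beta 0 0 U -> forall s, 0 <= s <= T ->
  U s = noise beta s + b * expR (b * s) *
    \int[mu]_(r in `[0, s]) (expR (- b * r) * noise beta r).
Proof.
move=> T0 cb sU s sT; have cU := continuous_comp_clamp T0 sU.1.
have cbc := continuous_comp_clamp T0 cb.
have cN : continuous (noise beta).
  move=> r; apply: cvgD.
    by apply: cvgM; [exact: cvg_cst|exact: continuous_clamp].
  apply: cvgM; first exact: cvg_cst.
  by apply: cvgB; [exact: cbc|exact: cvg_cst].
have := @linear_integral_eq R b _ _ 0 T cU cN _ s sT; rewrite clamp_id//; apply.
move=> r rT; rewrite (solvesE T0 sU rT) /noise clamp_id// add0r subr0.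
by congr (_ + _); rewrite addrC.
Qed.

(** If [B] bounds the noise and [E] both exponentials, the explicit formula is at most
    [B + |b| E (E B T)]; [L] is the resulting factor of [B]. *)
Lemma solves_bound beta U sigma : 0 <= T -> {within `[0, T], continuous beta} ->
  (forall s, 0 <= s <= T -> `|beta s - beta 0| <= sigma) ->
  solves beta 0 0 U -> forall s, 0 <= s <= T ->
  let L := 1 + `|b| * expR (`|b| * T) ^+ 2 * T in
  `|U s| <= L * (`|a| * T) + L * `|c| * sigma.
Proof.
move=> T0 cb bs sU s /[dup] sT /andP[s0 sT'] /=.
rewrite (solves_explicit T0 cb sU sT).
set E := expR (`|b| * T); pose B := `|a| * T + `|c| * sigma.
have NB r : `|noise beta r| <= B.
  have clr := clamp_in r T0; have /andP[c0 cT] := clr.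
  rewrite (le_trans (ler_normD _ _))// lerD// normrM ler_wpM2l//; last exact: bs.
  by rewrite ger0_norm.
have B0 : 0 <= B by apply: le_trans (NB 0).
have EE r : 0 <= r <= T -> expR (b * r) <= E /\ expR (- b * r) <= E.
  move=> /andP[r0 rT].
  have h y : `|y| = `|b| -> expR (y * r) <= E.
    move=> yb; rewrite ler_expR (le_trans (ler_norm _))// normrM yb (ger0_norm r0).
    by rewrite ler_wpM2l.
  by split; apply: h; rewrite ?normrN.
have cN : continuous (noise beta).
  have cbc := continuous_comp_clamp T0 cb.
  move=> r; apply: cvgD.
    by apply: cvgM; [exact: cvg_cst|exact: continuous_clamp].
  apply: cvgM; first exact: cvg_cst.
  by apply: cvgB; [exact: cbc|exact: cvg_cst].
have cE : continuous (fun r => expR (- b * r) * noise beta r).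
  move=> r; apply: cvgM; last exact: cN.
  apply: (cvg_comp (fun r => - b * r) expR); last exact: continuous_expR.
  by apply: cvgM; [exact: cvg_cst|exact: cvg_id].
have iE := continuous_integrable_itv 0 s cE.
have IB : `|\int[mu]_(r in `[0, s]) (expR (- b * r) * noise beta r)| <= E * B * T.
  apply: (le_trans (le_normr_Rintegral _ iE)) => //.
  apply: (@le_trans _ _ (\int[mu]_(r in `[0, s]) (E * B))).
    apply: le_Rintegral => //; first exact: integrable_norm.
      by apply: continuous_integrable_itv; exact: cst_continuous.
    move=> r /=; rewrite in_itv/= => /andP[r0 rs].
    rewrite normrM ler_pM// ger0_norm ?expR_ge0//.
    by have [] := EE r; rewrite ?r0 ?(le_trans rs).
  by rewrite Rintegral_cst_itv// subr0 ler_wpM2l// mulr_ge0// expR_ge0.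
have -> : (1 + `|b| * E ^+ 2 * T) * (`|a| * T) + (1 + `|b| * E ^+ 2 * T) * `|c| * sigma =
  B + `|b| * E * (E * B * T) by rewrite /B; ring.
rewrite (le_trans (ler_normD _ _))// lerD// !normrM.
rewrite ler_pM ?mulr_ge0// ler_wpM2l// ger0_norm ?expR_ge0//.
by have [] := EE s sT.
Qed.

End Solution.

Lemma measurable_solves (R : realType) d (Omega : measurableType d) (a b c T : R)
  (W U : R -> Omega -> R) : 0 <= T ->
  (forall t, 0 <= t -> measurable_fun setT (W t)) ->
  (forall w, {within `[0, T], continuous (W ^~ w)}) ->
  (forall w, solves a b c T (W ^~ w) 0 0 (U ^~ w)) ->
  forall s, 0 <= s <= T -> measurable_fun setT (U s).
Proof.
move=> T0 mW cW sU s /[dup] sT /andP[s0 _].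
have mN r : measurable_fun setT (fun w => noise a c T (W ^~ w) r).
  have /andP[cr _] := clamp_in r T0.
  apply: measurable_funD => //; apply: measurable_funM => //.
  by apply: measurable_funB; exact: mW.
rewrite (_ : U s = fun w => noise a c T (W ^~ w) s + b * expR (b * s) *
    \int[lebesgue_measure]_(r in `[0, s]) (expR (- b * r) * noise a c T (W ^~ w) r)).
  apply: measurable_funD => //; apply: measurable_funM => //.
  apply: measurable_Rintegral_itv => // [w r|r].
    apply: cvgM.
      apply: (cvg_comp (fun r => - b * r) expR); last exact: continuous_expR.
      by apply: cvgM; [exact: cvg_cst|exact: cvg_id].
    have cbc := continuous_comp_clamp T0 (cW w).
    apply: cvgD; first by apply: cvgM; [exact: cvg_cst|exact: continuous_clamp].
    apply: cvgM; first exact: cvg_cst.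
    by apply: cvgB; [exact: cbc|exact: cvg_cst].
  exact: measurable_funM.
by apply/funext => w; exact: (solves_explicit T0 (cW w) (sU w) sT).
Qed.

(** * Integrability of negligible series in the Brownian supremum *)

Section Moments.
Variables (R : realType) (d : measure_display) (Omega : measurableType d).
Variables (P : probability Omega R) (S : Omega -> R) (eps : R).
Hypothesis eps0 : 0 < eps.
Hypothesis mS : measurable_fun setT S.
Hypothesis expS : (\int[P]_w (expR (eps * S w ^+ 2))%:E < +oo)%E.

(** Since [(k + l S)^2 <= 2 k^2 + 2 l^2 S^2], a growth rate [eta] with [2 l^2 eta <= eps] is
    required, however large [l] is; negligibility supplies every rate. The [+ 1] in [L] covers
    [l = 0]. *)
Lemma integrable_pvalue_affine (k l : R) (r : nat -> R) : 0 <= k -> 0 <= l ->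
  (forall j, 0 <= r j) -> negl r ->
  P.-integrable setT (EFin \o (fun w => pvalue r (k + l * S w))).
Proof.
move=> k0 l0 r0 nr; pose L := 2 * l ^+ 2 + 1.
have L0 : 0 < L by rewrite ltr_wpDl// mulr_ge0// sqr_ge0.
pose eta := eps / L; have eta0 : 0 < eta by exact: divr_gt0.
have [C HC] := pvalue_bound nr eta0.
pose D := expR (eta * (2 * k ^+ 2)).
have mE : measurable_fun setT (fun w => expR (eps * S w ^+ 2)).
  by apply: measurableT_comp => //; apply: measurable_funM => //; exact: measurable_funX.
have iE : P.-integrable setT (fun w => (expR (eps * S w ^+ 2))%:E).
  apply/integrableP; split; first exact/measurable_EFinP.
  rewrite (_ : (\int[P]_x _ = \int[P]_w (expR (eps * S w ^+ 2))%:E)%E)//.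
  by apply: eq_integral => w _; rewrite gee0_abs// lee_fin expR_ge0.
have iG : P.-integrable setT (fun w => (`|C|%:E + D%:E * (expR (eps * S w ^+ 2))%:E)%E).
  by apply: integrableD => //; [exact: finite_measure_integrable_cst|exact: integrableZl].
apply: le_integrable iG => //.
  apply/measurable_EFinP; apply: measurableT_comp.
    by apply: continuous_measurable_fun; exact: continuous_pvalue.
  by apply: measurable_funD => //; exact: measurable_funM.
move=> w _; rewrite -EFinM -EFinD /= lee_fin [leRHS]ger0_norm; last first.
  by rewrite addr_ge0// mulr_ge0// expR_ge0.
apply: (le_trans (HC _)); apply: lerD; first exact: ler_norm.
rewrite /D -expRD ler_expR.
have h1 : (k + l * S w) ^+ 2 <= 2 * k ^+ 2 + 2 * l ^+ 2 * S w ^+ 2.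
  by have := sqr_ge0 (k - l * S w); rewrite sqrrB sqrrD exprMn; lra.
apply: (le_trans (ler_wpM2l (ltW eta0) h1)); rewrite mulrDr lerD2l.
rewrite mulrA ler_wpM2r ?sqr_ge0// /eta -mulrA ler_piMr ?(ltW eps0)//.
by rewrite mulrC ler_pdivrMr// mul1r lerDl.
Qed.

End Moments.

Lemma sqrtr_sqrD_le (R : realType) (x y : R) : Num.sqrt (x ^+ 2 + y ^+ 2) <= `|x| + `|y|.
Proof.
rewrite -[leRHS]ger0_norm ?addr_ge0// -sqrtr_sqr ler_wsqrtr// sqrrD.
rewrite !real_normK ?num_real// addrAC lerDl mulrn_wge0// mulr_ge0.
Qed.

(** The sign of the integrand decides, because [fine] sends an infinite integral to 0. *)
Lemma Rintegral_le0 (R : realType) d (Y : measurableType d) (m : {measure set Y -> \bar R})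
  (B : set Y) (f : Y -> R) : (forall y, B y -> f y <= 0) -> \int[m]_(y in B) f y <= 0.
Proof.
move=> f0; rewrite /Rintegral.
rewrite (_ : (fun y => (f y)%:E) = (fun y => - (- f y)%:E)%E); last first.
  by apply/funext => y; rewrite EFinN oppeK.
rewrite integral_ge0N; last by move=> y By; rewrite lee_fin oppr_ge0 f0.
rewrite fineN oppr_le0; apply: fine_ge0; apply: integral_ge0 => y By.
by rewrite lee_fin oppr_ge0 f0.
Qed.

(* Complex-valued data are given by real and imaginary parts (suffix r / i).
   Xf t x s w is the solution of dX = (a + b X) ds + c dW on [t, T]
   started at X_t = x.  fr / fi are the real / imaginary parts of f. *)
Theorem theorem6p4 (R : realType) (d : measure_display) (Omega : measurableType d)
  (P : probability Omega R) (W : R -> Omega -> R)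
  (a b c T : R) (u1r u1i u2r u2i u3r u3i vr vi : R -> R)
  (p p2 p3 q : nat -> R) (Xf : R -> R -> R -> Omega -> R) :
  brownian_motion P W ->
  c != 0 -> 0 < T ->
  {within `[0, T], continuous u1r} -> {within `[0, T], continuous u1i} ->
  {within `[0, T], continuous u2r} -> {within `[0, T], continuous u2i} ->
  {within `[0, T], continuous u3r} -> {within `[0, T], continuous u3i} ->
  {within `[0, T], continuous vr} -> {within `[0, T], continuous vi} ->
  (forall s, 0 <= s <= T -> u1r s <= 0) ->
  (forall s, 0 <= s <= T -> u2r s = 0) ->
  (forall s, 0 <= s <= T -> u3r s = 0) ->
  (forall s, 0 <= s <= T -> vr s = 0) ->
  negligible_dfact p -> negligible_dfact p2 -> negligible_dfact p3 ->
  negligible_dfact q ->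
  (forall t x w, 0 <= t <= T ->
     {within `[t, T], continuous (fun s => Xf t x s w)} /\
     (forall s, t <= s <= T ->
        Xf t x s w = x + Rintegral lebesgue_measure `[t, s]
                           (fun r => a + b * Xf t x r w)
                     + c * (W s w - W t w))) ->
  let p1 := psquare p in
  let fr := fun t x => Rintegral P setT (fun w =>
      expR (exponent_part T t u1r u2r u3r vr p1 p2 p3 q (fun s => Xf t x s w))
      * cos (exponent_part T t u1i u2i u3i vi p1 p2 p3 q (fun s => Xf t x s w))) in
  let fi := fun t x => Rintegral P setT (fun w =>
      expR (exponent_part T t u1r u2r u3r vr p1 p2 p3 q (fun s => Xf t x s w))
      * sin (exponent_part T t u1i u2i u3i vi p1 p2 p3 q (fun s => Xf t x s w))) in
  (forall (k : nat) t x, 0 <= t <= T ->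
     derivable (derive1n k (fr t)) x 1 /\ derivable (derive1n k (fi t)) x 1) /\
  (forall k : nat,
     {within [set z : R * R | 0 <= z.1 <= T],
        continuous (fun z : R * R => derive1n k (fr z.1) z.2)} /\
     {within [set z : R * R | 0 <= z.1 <= T],
        continuous (fun z : R * R => derive1n k (fi z.1) z.2)}) /\
  (forall k : nat, exists (qk : nat -> R) (Ck : R),
     negligible_dfact qk /\
     forall t x, 0 <= t <= T ->
       Num.sqrt ((derive1n k (fr t) x) ^+ 2 + (derive1n k (fi t) x) ^+ 2)
       <= pvalue (pabs qk) (`|x|) + Ck).
Proof.
move=> bm c0 T0 cu1r cu1i cu2r cu2i cu3r cu3i cvr cvi u1le u2e u3e vre ngp ngp2 ngp3 ngq HX.
move=> p1 fr fi; have T0' := ltW T0.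
have np := (negligible_dfactP p).1 ngp; have np2 := (negligible_dfactP p2).1 ngp2.
have np3 := (negligible_dfactP p3).1 ngp3; have nq := (negligible_dfactP q).1 ngq.
have np1 : negl p1 by exact: (negl_cauchy_prod np np).
(* The square structure of [p1] makes its values nonnegative, which together with the sign of [u1r]
   gives the sign of the real exponent. *)
have p1_ge0 y : 0 <= pvalue p1 y by rewrite (pvalue_cauchy_prod y np np) -expr2 sqr_ge0.
case: bm => mW _ cW lawW _.
have [eps [S [eps0 mS S0 WS expS]]] := brownian_sup_expR_sqr T0 mW cW lawW.
have cWT w : {within `[0, T], continuous (W ^~ w)}.
  apply: continuous_subspaceW (cW w) => s /=.
  by rewrite !in_itv/= => /andP[-> _].
have sol t x w : 0 <= t <= T -> solves a b c T (W ^~ w) t x (fun s => Xf t x s w).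
  by move=> tT; have [? H] := HX t x w tT; split.
have T00 : (0 : R) <= 0 <= T by apply/andP; split.
pose U s w := Xf 0 0 (clamp 0 T s) w.
have cU w : continuous (U ^~ w).
  exact: continuous_comp_clamp T0' (sol 0 0 w T00).1.
have mU s : measurable_fun setT (U s).
  exact: (measurable_solves T0' mW cWT (fun w => sol 0 0 w T00) (clamp_in s T0')).
pose L := 1 + `|b| * expR (`|b| * T) ^+ 2 * T.
have L0 : 0 <= L by rewrite addr_ge0// mulr_ge0// mulr_ge0// sqr_ge0.
pose M w := L * (`|a| * T) + L * `|c| * S w.
have M0 w : 0 <= M w by rewrite addr_ge0// mulr_ge0// mulr_ge0.
have UM s w : `|U s w| <= M w.
  exact: (solves_bound T0' (cWT w) (WS w) (sol 0 0 w T00) (clamp_in s T0')).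
have iM (r : nat -> R) : (forall k, 0 <= r k) -> negl r ->
    P.-integrable setT (EFin \o (fun w => pvalue r (M w))).
  by move=> r0 nr; apply: (integrable_pvalue_affine eps0 mS expS _ _ r0 nr); rewrite mulr_ge0// mulr_ge0.
pose A := exponent_field T b U u1r u2r u3r vr p1 p2 p3 q.
pose B := exponent_field T b U u1i u2i u3i vi p1 p2 p3 q.
have rA n : regular M n A by exact: regular_exponent.
have rB n : regular M n B by exact: regular_exponent.
have XE t x w s : 0 <= t <= T -> t <= s <= T ->
    Xf t x s w = U s w + expR (b * (s - t)) * (x - U t w).
  move=> tT tsT; rewrite /U !clamp_id//.
    exact: (solves_flow tT (sol 0 0 w T00) (sol t x w tT) tsT).
  by case/andP: tsT => ts ->; case/andP: tT => t0 _; rewrite (le_trans t0).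
have AE t x w : 0 <= t <= T -> exponent_part T t u1r u2r u3r vr p1 p2 p3 q
    (fun s => Xf t x s w) = A t x w.
  by move=> tT; apply: exponent_fieldE => // s tsT; exact: XE.
have BE t x w : 0 <= t <= T -> exponent_part T t u1i u2i u3i vi p1 p2 p3 q
    (fun s => Xf t x s w) = B t x w.
  by move=> tT; apply: exponent_fieldE => // s tsT; exact: XE.
have A_le0 t x w : A t x w <= 0.
  (* For clamped [t] the field is the genuine exponent, of whose real part only the [u1r] term
     survives. *)
  rewrite /A -exponent_field_clamp// -/A.
  have vT : vr T = 0 by apply: vre; rewrite T0' lexx.
  have tT := clamp_in t T0'; rewrite -AE// /exponent_part vT mul0r addr0.
  apply: Rintegral_le0 => s /=; rewrite in_itv/= => /andP[ts sT].
  have sT0 : 0 <= s <= T by case/andP: tT => t0 _; rewrite sT (le_trans t0).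
  by rewrite u2e// u3e// !mul0r !addr0 mulr_le0_ge0// u1le.
have rE n := regular_expR_trig A_le0 rA rB n.
have [dC cC bC] := regular_expect_smooth M0 iM (fun n => (rE n).1).
have [dS cS bS] := regular_expect_smooth M0 iM (fun n => (rE n).2).
have frE t : 0 <= t <= T -> fr t = expect P (fun t x w => expR (A t x w) * cos (B t x w)) t.
  by move=> tT; apply/funext => x; apply: eq_Rintegral => w _; rewrite AE// BE.
have fiE t : 0 <= t <= T -> fi t = expect P (fun t x w => expR (A t x w) * sin (B t x w)) t.
  by move=> tT; apply/funext => x; apply: eq_Rintegral => w _; rewrite AE// BE.
split; [|split].
- by move=> k t x tT; rewrite frE// fiE//.
- move=> k; split.
    (* The expectation of the field is continuous on the whole plane but agrees with [fr] only on
       the strip, hence continuity within it. *)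
    have h : {in [set z : R * R | 0 <= z.1 <= T],
        (fun z => derive1n k (expect P (fun t x w => expR (A t x w) * cos (B t x w)) z.1) z.2)
        =1 (fun z => derive1n k (fr z.1) z.2)}.
      by move=> z; rewrite inE/= => zT; rewrite frE.
    exact: (subspace_eq_continuous h (continuous_subspaceT (cC k))).
  have h : {in [set z : R * R | 0 <= z.1 <= T],
      (fun z => derive1n k (expect P (fun t x w => expR (A t x w) * sin (B t x w)) z.1) z.2)
      =1 (fun z => derive1n k (fi z.1) z.2)}.
    by move=> z; rewrite inE/= => zT; rewrite fiE.
  exact: (subspace_eq_continuous h (continuous_subspaceT (cS k))).
- move=> k; have [r [C [r0 nr HC]]] := bC k; have [r' [C' [r'0 nr' HC']]] := bS k.
  exists (fun j => r j + r' j), (C + C'); split.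
    by apply/negligible_dfactP; exact: neglD.
  move=> t x tT; rewrite frE// fiE//.
  rewrite (le_trans (sqrtr_sqrD_le _ _))// (_ : pabs _ = fun j => r j + r' j).
    by rewrite pvalueD// addrACA lerD.
  by apply/funext => j; rewrite /pabs ger0_norm// addr_ge0.
Qed.
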